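(* Let $H$ be a complex Hilbert space. Assume that $H=Y_i\oplus Z_i$ is an orthogonal decomposition into closed subspaces for $i=0$ and $i=1$, such that $1-S_1-S_0$ is compact, where $S_i$ denotes the projection onto $Y_i$. Let $G_i:Y_i\to Z_i$ ($i=0,1$) be bounded operators with $\|G_0\|_C\|G_1\|_C<1$. Let $P_i$ be the projection in $H$ onto the graph $\{x+G_ix\mid x\in Y_i\}$ of $G_i$. Then: (1) $(P_1,1-P_0)$ is a Fredholm pair. (2) $\operatorname{ind}(P_1,1-P_0)=\operatorname{ind}(S_1,1-S_0)$.
   Context: ''Projection'' means orthogonal projection onto a closed subspace of $H$. For a bounded operator $T:Y\to Z$ between Hilbert spaces, $\|T\|_C:=\inf\{\|T+K\| : K:Y\to Z\text{ compact}\}$; if $Y,Z$ are closed subspaces of $H$, this equals the norm in the Calkin algebra of $H$ of the extension of $T$ by zero on $Y^\perp$. A pair $(P,Q)$ of projections in $H$ is a Fredholm pair if the restricted operator $Q|_{\operatorname{Ran}(P)}:\operatorname{Ran}(P)\to\operatorname{Ran}(Q)$ is a Fredholm operator, and $\operatorname{ind}(P,Q)$ denotes the index ($\dim\ker-\dim\operatorname{coker}$) of this operator. It is known that $(P,Q)$ is a Fredholm pair if and only if $\|P-Q\|_C<1$, where $\|\cdot\|_C$ is the norm in the Calkin algebra of $H$. *)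

(* Defs.v *)
From HB Require Import structures.
From mathcomp Require Import all_boot all_order all_algebra.
From mathcomp Require Import sesquilinear complex.
From mathcomp Require Import boolp classical_sets reals topology normedtype.

Set Implicit Arguments.
Unset Strict Implicit.
Unset Printing Implicit Defensive.

Import Order.TTheory GRing.Theory Num.Theory.
Import numFieldNormedType.Exports.

Local Open Scope classical_set_scope.
Local Open Scope ring_scope.
Local Open Scope complex_scope.

(* [hdot] is linear in its first argument and conjugate-linear in its second. *)
HB.mixin Record CompleteNormedModule_isHilbert (R : realType) H
    of CompleteNormedModule R[i] H := {
  hdot : {dot H for (@Num.conj R[i])} ;
  hdot_norm : forall x : H, `|x| ^+ 2 = hdot x x
}.

#[short(type="hilbertType")]
HB.structure Definition Hilbert (R : realType) :=
  { H of CompleteNormedModule_isHilbert R H & CompleteNormedModule R[i] H }.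

Section Subspaces.
Context {R : realType} {H : hilbertType R}.
Implicit Types (Y Z V : set H) (P : H -> H).

(* The norm of [H] takes its values in R[i]; this is the same norm in [R]. *)
Definition hnorm (x : H) : R := complex.Re `|x|.

Definition closed_subspace Y : Prop :=
  [/\ Y 0,
      forall (a : R[i]) (x y : H), Y x -> Y y -> Y (a *: x + y)
    & closed Y].

Definition orthogonal_decomposition Y Z : Prop :=
  [/\ closed_subspace Y, closed_subspace Z,
      forall y z, Y y -> Z z -> hdot y z = 0
    & forall x, exists y z, [/\ Y y, Z z & x = y + z]].

(* By the projection theorem the set below is a singleton whenever [Y] is a
   closed subspace. *)
Definition proj Y (x : H) : H :=
  xget 0 [set y | Y y /\ forall z, Y z -> hdot (x - y) z = 0].

Definition is_projection P : Prop :=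
  exists2 Y, closed_subspace Y & P = proj Y.

(* [b] induces a basis of the quotient space Z / V. *)
Definition quotient_basis Z V n (b : 'I_n -> H) : Prop :=
  [/\ forall i, Z (b i),
      forall c : 'I_n -> R[i], V (\sum_i c i *: b i) -> forall i, c i = 0
    & forall z, Z z -> exists c : 'I_n -> R[i], V (z - \sum_i c i *: b i)].

Definition has_quotient_dim Z V (n : nat) : Prop :=
  exists b : 'I_n -> H, quotient_basis Z V b.

Definition finite_quotient_dim Z V : Prop := exists n, has_quotient_dim Z V n.

(* dim (Z / V), with the junk value 0 if Z / V is infinite-dimensional. *)
Definition quotient_dim Z V : nat := xget 0%N [set n | has_quotient_dim Z V n].

End Subspaces.

(* An operator between closed subspaces [Y] and [Z] of [H] is represented by a
   function [T : H -> H] of which only the restriction to [Y] is relevant. *)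
Section Operators.
Context {R : realType} {H : hilbertType R}.
Implicit Types (Y Z : set H) (T K P Q : H -> H).

Definition linear_operator Y Z T : Prop :=
  (forall x, Y x -> Z (T x)) /\
  (forall (a : R[i]) (x y : H), Y x -> Y y -> T (a *: x + y) = a *: T x + T y).

Definition bounded_operator Y Z T : Prop :=
  linear_operator Y Z T /\
  exists M : R, forall x, Y x -> hnorm (T x) <= M * hnorm x.

Definition compact_operator Y Z T : Prop :=
  linear_operator Y Z T /\
  precompact (T @` [set x | Y x /\ hnorm x <= 1]).

Definition op_norm Y T : R :=
  sup [set hnorm (T x) | x in [set x | Y x /\ hnorm x <= 1]].

Definition calkin_norm Y Z T : R :=
  inf [set op_norm Y (fun x => T x + K x) | K in [set K | compact_operator Y Z K]].

Definition kernel Y T : set H := [set x | Y x /\ T x = 0].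

Definition graph Y T : set H := [set x + T x | x in Y].

(* Closedness of the range [T @` Y] follows from the finite codimension. *)
Definition fredholm_operator Y Z T : Prop :=
  [/\ bounded_operator Y Z T,
      finite_quotient_dim (kernel Y T) [set 0]
    & finite_quotient_dim Z (T @` Y)].

Definition fredholm_index Y Z T : int :=
  (quotient_dim (kernel Y T) [set 0])%:Z - (quotient_dim Z (T @` Y))%:Z.

Definition fredholm_pair P Q : Prop :=
  [/\ is_projection P, is_projection Q
    & fredholm_operator (range P) (range Q) Q].

Definition pair_index P Q : int := fredholm_index (range P) (range Q) Q.

End Operators.

(* Main.v *)
Require Import Defs.
From mathcomp Require Import all_boot all_order all_algebra finmap.
From mathcomp Require Import sesquilinear complex.
From mathcomp Require Import boolp classical_sets reals topology normedtype.
From mathcomp Require Import sequences.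
From mathcomp Require Import zify ring lra.

(** Write [c0 = 1 - S0] and [K = 1 - S1 - S0].  A vector [v] lies on the graph
    of [G0] exactly when its defect [c0 v - G0 (S0 v)], a vector of [Z0],
    vanishes.  The defect and [1 - P0] have the same kernel, so each factors
    through the other, and composing with the parametrization [x |-> x + G1 x]
    of the graph of [G1] shows that [1 - P0], restricted to the range of [P1],
    has the same kernel and cokernel dimensions as
      [A x = c0 (x + G1 x) - G0 (S0 (x + G1 x)) : Y1 -> Z0].

    Put [g0 = G0 S0] and [g1 = G1 S1].  On [Y1] one has [S0 x = - K x], and
    [c0 z = K z] for [z] in [Z1]; hence [A = c0 + K g1 + g0 K - g0 g1] on [Y1]
    ([graph_operatorE]).  In a Hilbert space a compact operator is the sum of an
    operator of finite rank and one of arbitrarily small norm ([compact_approx]).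
    Therefore, modulo finite rank, [K] may be taken as small as desired and
    [g0], [g1] may be replaced by operators whose norms have a product below 1,
    so that [A = c0 + L + finite rank] with [L : Y1 -> Z0] of norm below 1.

    Finally [S1 c0 = 1 + S1 K] on [Y1], so modulo finite rank [c0] has the left
    inverse [V S1], where [V] is a Neumann series whose norm exceeds 1 as little
    as desired; hence [A = (1 + L V S1) c0 + finite rank], and [1 + L V S1] is
    invertible on [Z0] by a second Neumann series ([fredholm_dims_perturb]).
    The index of [A] is thus that of [c0 : Y1 -> Z0], which is the pair index of
    [(S1, 1 - S0)]; it is finite because [S1] is an inverse of [c0] modulo compact operators
    ([fredholm_complementary]).

    What remains of Fredholm theory is then the invariance of the index under
    perturbations of finite rank ([fredholm_dims_finite_rank]), a statement of
    linear algebra: [T] and [T + f t] agree on the kernel of the linear form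
    [f], and restricting an operator to a hyperplane lowers its index by 1. *)

Set Implicit Arguments.
Unset Strict Implicit.
Unset Printing Implicit Defensive.

Import Order.TTheory GRing.Theory Num.Theory.
Import numFieldNormedType.Exports.

Local Open Scope classical_set_scope.
Local Open Scope ring_scope.

(** * Dimensions of quotients *)

Section Dimension.
Context {K : fieldType} {H : lmodType K}.
Implicit Types (Y Z V W : set H) (T F : H -> H).

(** The counting arguments involve no topology, so they are carried out over an
    arbitrary field; over a Hilbert space these predicates unfold to
    [quotient_basis] and [has_quotient_dim]. *)
Definition mod_basis Z V n (b : 'I_n -> H) : Prop :=
  [/\ forall i, Z (b i),
      forall c : 'I_n -> K, V (\sum_i c i *: b i) -> forall i, c i = 0
    & forall z, Z z -> exists c : 'I_n -> K, V (z - \sum_i c i *: b i)].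

Definition dim_mod Z V n : Prop := exists b : 'I_n -> H, mod_basis Z V b.

Definition linear_on Y Z T : Prop :=
  (forall x, Y x -> Z (T x)) /\
  (forall (a : K) (x y : H), Y x -> Y y -> T (a *: x + y) = a *: T x + T y).

Definition linear_subspace Y : Prop :=
  Y 0 /\ forall (a : K) (x y : H), Y x -> Y y -> Y (a *: x + y).

Lemma subspaceD Y x y : linear_subspace Y -> Y x -> Y y -> Y (x + y).
Proof. by move=> [_ sY] Yx Yy; rewrite -[x]scale1r; exact: sY. Qed.

Lemma subspaceZ Y (a : K) x : linear_subspace Y -> Y x -> Y (a *: x).
Proof. by move=> [Y0 sY] Yx; rewrite -[_ *: _]addr0; exact: sY. Qed.

Lemma subspaceB Y x y : linear_subspace Y -> Y x -> Y y -> Y (x - y).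
Proof.
by move=> sY Yx Yy; rewrite -[- y]scaleN1r; apply: subspaceD => //; exact: subspaceZ.
Qed.

Lemma subspace_sum Y n (F : 'I_n -> H) :
  linear_subspace Y -> (forall i, Y (F i)) -> Y (\sum_i F i).
Proof.
move=> sY YF; apply: big_rec => [|i x _ Yx]; first by case: sY.
exact: subspaceD.
Qed.

Lemma subspace_unscale Y (a : K) x :
  linear_subspace Y -> a != 0 -> Y (a *: x) -> Y x.
Proof. by move=> sY a0 /(subspaceZ a^-1 sY); rewrite scalerK. Qed.

Lemma subspace0 : linear_subspace [set 0 : H].
Proof. by split=> // a x y /= -> ->; rewrite scaler0 addr0. Qed.

Definition add_line V (v : H) : set H := [set x | exists c : K, V (x - c *: v)].

Lemma subspace_add_line V v : linear_subspace V -> linear_subspace (add_line V v).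
Proof.
move=> sV; split; first by exists 0; rewrite scale0r subr0; case: sV.
move=> a x y [c Vx] [d Vy]; exists (a * c + d).
rewrite scalerDl opprD addrACA -scalerA -scalerBr.
by case: sV => _; apply.
Qed.

Lemma add_line_sub V v : V `<=` add_line V v.
Proof. by move=> x Vx; exists 0; rewrite scale0r subr0. Qed.

Lemma add_line_mem V v : linear_subspace V -> add_line V v v.
Proof. by case=> V0 _; exists 1; rewrite scale1r subrr. Qed.

Lemma add_line_least V W v : linear_subspace W -> V `<=` W -> W v -> add_line V v `<=` W.
Proof.
move=> sW VW Wv x [c Vx]; rewrite -[x](subrK (c *: v)).
by apply: subspaceD => //; [exact: (VW _ Vx) | exact: subspaceZ].
Qed.

Definition ocons n (A : Type) (x : A) (b : 'I_n -> A) (i : 'I_n.+1) : A :=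
  oapp b x (unlift ord0 i).

Lemma ocons0 n A (x : A) (b : 'I_n -> A) : ocons x b ord0 = x.
Proof. by rewrite /ocons unlift_none. Qed.

Lemma oconsS n A (x : A) (b : 'I_n -> A) i : ocons x b (lift ord0 i) = b i.
Proof. by rewrite /ocons liftK. Qed.

Let oconsE := (@ocons0, @oconsS).

Lemma sum_ocons n (c : 'I_n.+1 -> K) (v : H) (b : 'I_n -> H) :
  \sum_i c i *: ocons v b i = c ord0 *: v + \sum_i c (lift ord0 i) *: b i.
Proof.
by rewrite big_ord_recl ocons0; congr (_ + _); apply: eq_bigr => i _; rewrite oconsS.
Qed.

Lemma dim_mod_remove_line Z V v n : linear_subspace V -> Z v -> ~ V v ->
  dim_mod Z (add_line V v) n -> dim_mod Z V n.+1.
Proof.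
move=> sV Zv nVv [b [Zb b_free b_span]]; exists (ocons v b); split.
- by move=> i; case: (unliftP ord0 i) => [j|] ->; rewrite oconsE.
- move=> c; rewrite sum_ocons => Vc.
  have cS : forall i, c (lift ord0 i) = 0.
    apply: (b_free (fun i => c (lift ord0 i))); exists (- c ord0).
    by rewrite scaleNr opprK addrC.
  move=> i; case: (unliftP ord0 i) => [j|] -> //.
  apply/eqP; apply: contra_notT nVv => c0; apply: subspace_unscale (sV) c0 _.
  by move: Vc; rewrite big1 ?addr0// => j _; rewrite cS scale0r.
- move=> z /b_span[c [d Vz]]; exists (ocons d c).
  rewrite sum_ocons ocons0 opprD addrCA addrA [- _ + _]addrC in Vz *.
  by under eq_bigr do rewrite oconsS; rewrite addrAC.
Qed.

(** Steinitz exchange: [v] has a nonzero coordinate along some basis vector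
    [b k], and then the other basis vectors form a basis modulo [V] and [v]. *)
Lemma dim_mod_add_line Z V v n : linear_subspace V -> Z v -> ~ V v ->
  dim_mod Z V n.+1 -> dim_mod Z (add_line V v) n.
Proof.
move=> sV Zv nVv [b [Zb b_free b_span]].
have [c Vvc] := b_span v Zv.
have [k ck] : exists k, c k != 0.
  apply: contrapT => /forallNP c0; apply: nVv.
  rewrite big1 ?subr0 // in Vvc => i _.
  by have /negP/negPn/eqP -> := c0 i; rewrite scale0r.
exists (fun i => b (lift k i)); split=> //.
- move=> e [d Ve]; pose f i := oapp e 0 (unlift k i).
  have fk : f k = 0 by rewrite /f unlift_none.
  have fl i : f (lift k i) = e i by rewrite /f liftK.
  have Ef : \sum_i e i *: b (lift k i) = \sum_i f i *: b i.
    by rewrite [RHS](bigD1_ord k) //= fk scale0r add0r; apply: eq_bigr => i _; rewrite fl.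
  have f_comb : forall i, f i - d * c i = 0.
    apply: b_free; under eq_bigr do rewrite scalerBl -scalerA.
    rewrite sumrB -scaler_sumr -Ef.
    have := subspaceD sV Ve (subspaceZ d sV Vvc).
    by rewrite scalerBr addrA subrK.
  have := f_comb k; rewrite fk sub0r => /eqP; rewrite oppr_eq0 mulf_eq0 (negPf ck).
  rewrite orbF => /eqP d0 i.
  by have := f_comb (lift k i); rewrite fl d0 mul0r subr0.
- move=> z /b_span[e Vz]; pose r := e k / c k.
  exists (fun i => e (lift k i) - r * c (lift k i)); exists r.
  have := subspaceB sV Vz (subspaceZ r sV Vvc).
  congr V; rewrite scalerBr opprB.
  under [in RHS]eq_bigr do rewrite scalerBl -scalerA.
  rewrite sumrB -scaler_sumr.
  rewrite (bigD1_ord k (F := fun i => e i *: b i)) //.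
  rewrite (bigD1_ord k (F := fun i => c i *: b i)) //.
  rewrite scalerDr scalerA divfK //.
  by rewrite !opprD !opprK [- (e k *: b k) - _]addrC -!addrA addKr.
Qed.

Lemma dim_mod_extend Z V v n : linear_subspace Z -> V `<=` Z -> ~ Z v ->
  dim_mod Z V n -> dim_mod (add_line Z v) V n.+1.
Proof.
move=> sZ VZ nZv [b [Zb b_free b_span]]; exists (ocons v b); split.
- move=> i; case: (unliftP ord0 i) => [j|] ->; rewrite oconsE.
    exact: add_line_sub.
  exact: add_line_mem.
- move=> c; rewrite sum_ocons => Vc.
  have c0 : c ord0 = 0.
    apply/eqP; apply: contra_notT nZv => c0; apply: subspace_unscale (sZ) c0 _.
    have := subspaceB sZ (VZ _ Vc) (subspace_sum sZ (fun j =>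
      subspaceZ (c (lift ord0 j)) sZ (Zb j))).
    by rewrite addrK.
  move=> i; case: (unliftP ord0 i) => [j|] -> //.
  by apply: (b_free (fun j => c (lift ord0 j))); rewrite c0 scale0r add0r in Vc.
- move=> z [d /b_span[c Vz]]; exists (ocons d c).
  by rewrite sum_ocons ocons0 opprD addrA; under eq_bigr do rewrite oconsS.
Qed.

Lemma dim_mod0P Z V : dim_mod Z V 0 <-> Z `<=` V.
Proof.
split=> [[b [_ _ b_span]] z /b_span[c]|ZV]; first by rewrite big_ord0 subr0.
by exists (fun=> 0); split=> [[]//|c _ []//|z /ZV Vz]; exists (fun=> 0); rewrite big_ord0 subr0.
Qed.

(** The coordinates of a family that is free modulo [V] in a family spanning
    modulo [V] form a matrix with independent rows. *)
Lemma dim_mod_le Z V m n : linear_subspace V ->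
  dim_mod Z V m -> dim_mod Z V n -> (m <= n)%N.
Proof.
move=> sV [b [Zb b_free _]] [b' [_ _ b'_span]].
pose M := \matrix_(i < m, j < n) sval (cid (b'_span _ (Zb i))) j.
have VM i : V (b i - \sum_j M i j *: b' j).
  have := svalP (cid (b'_span _ (Zb i))).
  by under [in X in _ -> X]eq_bigr do rewrite mxE.
suff : row_free M by rewrite -row_leq_rank => /leq_trans -> //; exact: rank_leq_col.
rewrite -kermx_eq0; apply/eqP/row_matrixP => i; rewrite row0.
set u := row i _; have uM : u *m M = 0 by rewrite -row_mul mulmx_ker row0.
apply/rowP => k; rewrite [RHS]mxE; move: k; apply: (b_free (fun k => u 0 k)).
have := subspace_sum sV (fun k => subspaceZ (u 0 k) sV (VM k)).
congr V; under eq_bigr do rewrite scalerBr scaler_sumr.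
rewrite sumrB exchange_big /= [X in _ - X]big1 ?subr0 // => j _.
under eq_bigr do rewrite scalerA.
by rewrite -scaler_suml; have /rowP/(_ j) := uM; rewrite !mxE => ->; rewrite scale0r.
Qed.

Lemma dim_mod_unique Z V m n : linear_subspace V ->
  dim_mod Z V m -> dim_mod Z V n -> m = n.
Proof. by move=> sV dm dn; apply/eqP; rewrite eqn_leq !(dim_mod_le sV (Z := Z)). Qed.

(** By induction on [n]: a vector of [Z1] outside [V] is added to [V], which
    lowers the dimension of the ambient quotient. *)
Lemma finite_dim_mod_sub Z1 Z V n : linear_subspace V -> V `<=` Z1 -> Z1 `<=` Z ->
  linear_subspace Z1 -> dim_mod Z V n -> exists m, dim_mod Z1 V m.
Proof.
move=> + + Z1Z sZ1; elim: n V => [|n IH] V sV VZ1.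
  by move=> /dim_mod0P ZV; exists 0%N; apply/dim_mod0P => x /Z1Z/ZV.
move=> dn; have [Z1V|/existsNP[v /not_implyP[Z1v nVv]]] := pselect (Z1 `<=` V).
  by exists 0%N; apply/dim_mod0P.
have Zv := Z1Z _ Z1v.
have [|m dm] := IH (add_line V v) (subspace_add_line _ sV) _
  (dim_mod_add_line sV Zv nVv dn); first exact: add_line_least.
by exists m.+1; exact: dim_mod_remove_line dm.
Qed.

Lemma finite_dim_mod_quot Z V1 V n : linear_subspace V -> V `<=` V1 -> V1 `<=` Z ->
  linear_subspace V1 -> dim_mod Z V n -> exists m, dim_mod Z V1 m.
Proof.
move=> + + V1Z sV1; elim: n V => [|n IH] V sV VV1.
  by move=> /dim_mod0P ZV; exists 0%N; apply/dim_mod0P => x /ZV/VV1.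
move=> dn; have [V1V|/existsNP[v /not_implyP[V1v nVv]]] := pselect (V1 `<=` V).
  by exists n.+1; have -> : V1 = V by rewrite eqEsubset.
apply: (IH (add_line V v)); first exact: subspace_add_line.
  exact: add_line_least.
exact: dim_mod_add_line (V1Z _ V1v) nVv dn.
Qed.

Lemma linear_on_sum Y Z T n (c : 'I_n -> K) (b : 'I_n -> H) :
  linear_subspace Y -> linear_on Y Z T -> (forall i, Y (b i)) ->
  T (\sum_i c i *: b i) = \sum_i c i *: T (b i).
Proof.
move=> sY [_ linT] Yb.
have T0 : T 0 = 0.
  have /eqP := linT 1 0 0 sY.1 sY.1.
  by rewrite !scale1r addr0 -subr_eq0 opprD addrA subrr sub0r oppr_eq0 => /eqP.
suff : Y (\sum_i c i *: b i) /\ T (\sum_i c i *: b i) = \sum_i c i *: T (b i) by case.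
apply: (big_rec2 (fun x y => Y x /\ T x = y)); first by split=> //; exact: sY.1.
move=> i x y _ [Yx Tx]; split; first exact: sY.2.
by rewrite linT // Tx.
Qed.

(** The two conditions on [T] say that it induces an isomorphism from [Z / V]
    to [Z' / V']. *)
Lemma dim_mod_transfer Z V Z' V' T n : linear_subspace Z -> linear_on Z Z' T ->
  linear_subspace V' ->
  (forall z, Z z -> (V' (T z) <-> V z)) ->
  (forall z', Z' z' -> exists2 z, Z z & V' (z' - T z)) ->
  dim_mod Z V n -> dim_mod Z' V' n.
Proof.
move=> sZ linT sV' VT surjT [b [Zb b_free b_span]].
exists (fun i => T (b i)); split=> [i|c V'c|z' /surjT[z Zz V'z]].
- exact: linT.1.
- apply: b_free; apply/VT; last by rewrite (linear_on_sum _ sZ linT).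
  by apply: subspace_sum => // i; exact: subspaceZ.
- have [c Vz] := b_span z Zz; exists c.
  have Zc : Z (\sum_i c i *: b i).
    by apply: subspace_sum => // i; exact: subspaceZ.
  move: Vz => /VT -/(_ (subspaceB sZ Zz Zc)).
  rewrite -[_ - _]addrC -scaleN1r linT.2 // scaleN1r.
  rewrite (linear_on_sum _ sZ linT) // => /(subspaceD sV' V'z).
  by rewrite [- _ + T z]addrC addrA subrK.
Qed.

End Dimension.

(** * Fredholm dimensions and rank-one perturbations *)

Section FredholmDims.
Context {K : fieldType} {H : lmodType K}.
Implicit Types (Y Z V W : set H) (T F : H -> H).

Definition ker_on Y T : set H := [set x | Y x /\ T x = 0].

(** Carrying both dimensions as a relation, rather than the index as a number,
    lets finiteness and the index be transported together; a change of operator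
    preserves the index when [a + b' = a' + b]. *)
Definition fredholm_dims Y Z T (a b : nat) : Prop :=
  dim_mod (ker_on Y T) [set 0] a /\ dim_mod Z (T @` Y) b.

Lemma linear_on0 Y Z T : linear_subspace Y -> linear_on Y Z T -> T 0 = 0.
Proof.
move=> [Y0 _] [_ linT]; have /eqP := linT 1 0 0 Y0 Y0.
by rewrite !scale1r addr0 -subr_eq0 opprD addrA subrr sub0r oppr_eq0 => /eqP.
Qed.

Lemma linear_onB Y Z T x y : linear_subspace Y -> linear_on Y Z T ->
  Y x -> Y y -> T (x - y) = T x - T y.
Proof.
by move=> sY [_ linT] Yx Yy; rewrite addrC -scaleN1r linT // scaleN1r addrC.
Qed.

Lemma linear_on_sub Y1 Y Z T : Y1 `<=` Y -> linear_on Y Z T -> linear_on Y1 Z T.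
Proof.
move=> Y1Y [TZ linT]; split=> [x /Y1Y/TZ//|a x y /Y1Y Yx /Y1Y Yy].
exact: linT.
Qed.

Lemma subspace_ker_on Y Z T : linear_subspace Y -> linear_on Y Z T -> linear_subspace (ker_on Y T).
Proof.
move=> sY linT; split; first by split; [exact: sY.1 | exact: linear_on0 linT].
move=> a x y [Yx Tx] [Yy Ty]; split; first exact: sY.2.
by rewrite linT.2 // Tx Ty scaler0 addr0.
Qed.

Lemma subspace_image Y Z T : linear_subspace Y -> linear_on Y Z T -> linear_subspace (T @` Y).
Proof.
move=> sY linT; split.
  by exists 0; [exact: sY.1 | exact: linear_on0 linT].
move=> a _ _ [x Yx <-] [y Yy <-]; exists (a *: x + y); first exact: sY.2.
by rewrite linT.2.
Qed.

(** Extending [T] by a vector whose image is already attained by [y] enlarges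
    the kernel by the line of [v - y] and leaves the image unchanged. *)
Lemma ker_image_add_line_in Y Z T v y : linear_subspace Y -> ~ Y v ->
  linear_on (add_line Y v) Z T -> Y y -> T v = T y ->
  ker_on (add_line Y v) T = add_line (ker_on Y T) (v - y) /\
  T @` add_line Y v = T @` Y.
Proof.
move=> sY nYv linT Yy Tvy.
have sYv := subspace_add_line v sY.
have Yv_v : add_line Y v v := add_line_mem v sY.
have YYv : Y `<=` add_line Y v := @add_line_sub _ _ Y v.
have Tu : T (v - y) = 0.
  by rewrite (linear_onB sYv linT) ?Tvy ?subrr //; exact: YYv.
have Yv_u : add_line Y v (v - y) by apply: subspaceB => //; exact: YYv.
have split_u x c : x - c *: v = (x - c *: (v - y)) - c *: y.
  by rewrite scalerBr opprB addrA addrAC addrK.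
split; rewrite eqEsubset; split.
- move=> x [[c Yx] Tx]; exists c; split.
    by rewrite -[_ - _](subrK (c *: y)) -split_u; apply: subspaceD => //; exact: subspaceZ.
  rewrite (linear_onB sYv linT) //; [|by exists c|exact: subspaceZ].
  by rewrite -[c *: _]addr0 linT.2 ?Tu ?(linear_on0 sYv linT) //
     ?scaler0 ?Tx ?addr0 ?subr0 //; exact: sYv.1.
- apply: add_line_least; first exact: subspace_ker_on linT.
    by move=> x [Yx Tx]; split=> //; exact: YYv.
  by split.
- move=> _ [x [c Yx] <-]; exists (x - c *: (v - y)).
    by rewrite -[_ - _](subrK (c *: y)) -split_u; apply: subspaceD => //; exact: subspaceZ.
  rewrite (linear_onB sYv linT) //; [|by exists c|exact: subspaceZ].
  by rewrite -[c *: _]addr0 linT.2 ?Tu ?(linear_on0 sYv linT) //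
     ?scaler0 ?addr0 ?subr0 //; exact: sYv.1.
- by move=> _ [x /YYv Yx <-]; exists x.
Qed.

(** Extending [T] by a vector whose image is new creates no kernel and enlarges
    the image by a line. *)
Lemma ker_image_add_line_notin Y Z T v : linear_subspace Y ->
  linear_on (add_line Y v) Z T -> ~ (T @` Y) (T v) ->
  ker_on (add_line Y v) T = ker_on Y T /\
  T @` add_line Y v = add_line (T @` Y) (T v).
Proof.
move=> sY linT nTYv.
have sYv := subspace_add_line v sY.
have Yv_v : add_line Y v v := add_line_mem v sY.
have YYv : Y `<=` add_line Y v := @add_line_sub _ _ Y v.
have linTY := linear_on_sub YYv linT.
have TB x c : add_line Y v x -> T (x - c *: v) = T x - c *: T v.
  by move=> Yx; rewrite addrC -scaleNr linT.2 // scaleNr addrC.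
split; rewrite eqEsubset; split.
- move=> x [[c Yx] Tx]; split=> //; suff c0 : c = 0 by move: Yx; rewrite c0 scale0r subr0.
  apply/eqP; apply: contra_notT nTYv => c0.
  exists (- c^-1 *: (x - c *: v)); first exact: subspaceZ.
  rewrite -[_ *: _]addr0 linTY.2 //; last exact: sY.1.
  rewrite (linear_on0 sY linTY) addr0 TB; last by exists c.
  by rewrite Tx sub0r scalerN scaleNr opprK scalerK.
- by move=> x [Yx Tx]; split=> //; exact: YYv.
- by move=> _ [x [c Yx] <-]; exists c; exists (x - c *: v); rewrite ?TB //; exists c.
- apply: add_line_least; first exact: subspace_image linT.
    by move=> _ [x /YYv Yx <-]; exists x.
  by exists v.
Qed.

(** In both cases of the dichotomy on [T v], the index drops by 1: either the
    kernel loses a dimension or the cokernel gains one. *)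
Lemma fredholm_dims_remove_line Y Z T v a b : linear_subspace Y -> linear_subspace Z -> ~ Y v ->
  linear_on (add_line Y v) Z T -> fredholm_dims (add_line Y v) Z T a b ->
  exists a' b', fredholm_dims Y Z T a' b' /\ (a' + b).+1 = (a + b')%N.
Proof.
move=> sY sZ nYv linT [da db].
have sYv := subspace_add_line v sY.
have YYv : Y `<=` add_line Y v := @add_line_sub _ _ Y v.
have linTY := linear_on_sub YYv linT.
have [[y Yy /esym Tvy]|nTYv] := pselect ((T @` Y) (T v)).
  have [kerE imE] := ker_image_add_line_in sY nYv linT Yy Tvy.
  rewrite imE in db; rewrite kerE in da.
  have sk := subspace_ker_on sY linTY.
  have nku : ~ ker_on Y T (v - y).
    by move=> [/subspaceD - /(_ y sY Yy)]; rewrite subrK.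
  have k0 : [set 0] `<=` ker_on Y T by move=> _ ->; exact: sk.1.
  have [a' da'] : exists m, dim_mod (ker_on Y T) [set 0] m.
    apply: finite_dim_mod_sub da => //; first exact: subspace0.
    exact: add_line_sub.
  exists a', b; split=> //.
  by rewrite (dim_mod_unique subspace0 da (dim_mod_extend sk k0 nku da')).
have [kerE imE] := ker_image_add_line_notin sY linT nTYv.
rewrite imE in db; rewrite kerE in da.
exists a, b.+1; split; last by rewrite addnS.
split=> //; apply: dim_mod_remove_line db => //; first exact: subspace_image linTY.
by apply: linT.1; exact: add_line_mem.
Qed.

Lemma fredholm_dims_add_line Y Z T v a b : linear_subspace Y -> linear_subspace Z -> ~ Y v ->
  linear_on (add_line Y v) Z T -> fredholm_dims Y Z T a b ->
  exists a' b', fredholm_dims (add_line Y v) Z T a' b' /\ (a + b').+1 = (a' + b)%N.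
Proof.
move=> sY sZ nYv linT [da db].
have sYv := subspace_add_line v sY.
have YYv : Y `<=` add_line Y v := @add_line_sub _ _ Y v.
have linTY := linear_on_sub YYv linT.
have [[y Yy /esym Tvy]|nTYv] := pselect ((T @` Y) (T v)).
  have [kerE imE] := ker_image_add_line_in sY nYv linT Yy Tvy.
  have sk := subspace_ker_on sY linTY.
  have nku : ~ ker_on Y T (v - y).
    by move=> [/subspaceD - /(_ y sY Yy)]; rewrite subrK.
  have k0 : [set 0] `<=` ker_on Y T by move=> _ ->; exact: sk.1.
  exists a.+1, b; split=> //; rewrite /fredholm_dims kerE imE; split=> //.
  exact: dim_mod_extend.
have [kerE imE] := ker_image_add_line_notin sY linT nTYv.
have ZTv : Z (T v) by apply: linT.1; exact: add_line_mem.
case: b db => [/dim_mod0P/(_ _ ZTv)//|b db].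
exists a, b; split; last by rewrite addnS.
rewrite /fredholm_dims kerE imE; split=> //.
by apply: dim_mod_add_line => //; exact: subspace_image linTY.
Qed.

Definition linear_form (f : H -> K) : Prop :=
  forall (a : K) (x y : H), f (a *: x + y) = a * f x + f y.

(** Finite sums of rank-one operators; the inductive form makes every argument
    about finite rank an induction whose step adds one rank-one operator. *)
Inductive finite_rank Z : (H -> H) -> Prop :=
| finite_rank0 : finite_rank Z (fun=> 0)
| finite_rankD1 F f t : finite_rank Z F -> linear_form f -> Z t ->
    finite_rank Z (fun x => F x + f x *: t).

(** [T] and its perturbation coincide on the kernel [Y1] of [f].  If [Y1] is not
    all of [Y], it is a hyperplane, and the index drops by 1 when going from [Y]
    to [Y1] and rises by 1 on the way back. *)
Lemma fredholm_dims_rank1 Y Z T f t a b : linear_subspace Y -> linear_subspace Z ->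
  linear_on Y Z T -> linear_form f -> Z t -> fredholm_dims Y Z T a b ->
  exists a' b', fredholm_dims Y Z (fun x => T x + f x *: t) a' b' /\
    (a + b')%N = (a' + b)%N.
Proof.
move=> sY sZ linT linf Zt dT; set T' : H -> H := fun x => T x + f x *: t.
have linT' : linear_on Y Z T'.
  split=> [x Yx|c x y Yx Yy]; rewrite /T'.
    by apply: subspaceD => //; [exact: linT.1 | exact: subspaceZ].
  by rewrite linT.2 // linf scalerDl scalerDr scalerA addrACA.
have f0 : f 0 = 0 by have := linf (-1) 0 0; rewrite scaler0 addr0 mulN1r addNr.
pose Y1 : set H := [set x | Y x /\ f x = 0].
have sY1 : linear_subspace Y1.
  split; first by split=> //; exact: sY.1.
  move=> c x y [Yx fx] [Yy fy]; split; first exact: sY.2.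
  by rewrite linf fx fy mulr0 addr0.
have Y1E T0 : (forall x, Y1 x -> T0 x = T x) -> ker_on Y1 T0 = ker_on Y1 T /\
    T0 @` Y1 = T @` Y1.
  move=> T0E; split; rewrite eqEsubset; split.
  - by move=> x [Y1x /=]; rewrite T0E.
  - by move=> x [Y1x Tx]; split=> //; rewrite T0E.
  - by move=> _ [x Y1x <-]; exists x => //; rewrite T0E.
  - by move=> _ [x Y1x <-]; exists x => //; rewrite T0E.
have [kE iE] : ker_on Y1 T' = ker_on Y1 T /\ T' @` Y1 = T @` Y1.
  by apply: Y1E => x [_ fx]; rewrite /T' fx scale0r addr0.
have [YY1|/existsNP[v /not_implyP[Yv nY1v]]] := pselect (Y `<=` Y1).
  have Y1Y : Y1 = Y by rewrite eqEsubset; split=> // x [].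
  by exists a, b; split=> //; rewrite /fredholm_dims -Y1Y kE iE Y1Y.
have fv : f v != 0 by apply: contra_notN nY1v => /eqP fv.
have Y1v : add_line Y1 v = Y.
  rewrite eqEsubset; split; first by apply: add_line_least => // x [].
  move=> x Yx; exists (f x / f v); split.
    by apply: subspaceB => //; exact: subspaceZ.
  by rewrite addrC -scaleNr linf mulNr divfK // addNr.
rewrite -Y1v in linT linT' dT *.
have [a1 [b1 [d1 E1]]] := fredholm_dims_remove_line sY1 sZ nY1v linT dT.
have d1' : fredholm_dims Y1 Z T' a1 b1 by rewrite /fredholm_dims kE iE.
have [a2 [b2 [d2 E2]]] := fredholm_dims_add_line sY1 sZ nY1v linT' d1'.
by exists a2, b2; split=> //; lia.
Qed.

Lemma fredholm_dims_finite_rank Y Z T F a b : linear_subspace Y -> linear_subspace Z ->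
  linear_on Y Z T -> finite_rank Z F -> fredholm_dims Y Z T a b ->
  exists a' b', fredholm_dims Y Z (fun x => T x + F x) a' b' /\
    (a + b')%N = (a' + b)%N.
Proof.
move=> sY sZ linT rF dT.
have : linear_on Y Z (fun x => T x + F x) /\
  exists a' b', fredholm_dims Y Z (fun x => T x + F x) a' b' /\
    (a + b')%N = (a' + b)%N; last by case.
elim: F / rF => [|F f t _ [linTF [a1 [b1 [d1 E1]]]] linf Zt].
  under eq_fun do rewrite addr0.
  by split=> //; exists a, b.
under eq_fun do rewrite addrA.
have [a2 [b2 [d2 E2]]] := fredholm_dims_rank1 sY sZ linTF linf Zt d1.
split; last by exists a2, b2; split=> //; lia.
split=> [x Yx|c x y Yx Yy].
  by apply: subspaceD => //; [exact: linTF.1 | exact: subspaceZ].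
by rewrite linTF.2 // linf scalerDl -scalerA addrACA -scalerDr.
Qed.

End FredholmDims.

(** * Operators of finite rank *)

Section FiniteRank.
Context {K : fieldType} {H : lmodType K}.
Implicit Types (Z : set H) (F L : H -> H).

Definition linear_map L : Prop :=
  forall (a : K) (x y : H), L (a *: x + y) = a *: L x + L y.

Lemma linear_mapB L x y : linear_map L -> L (x - y) = L x - L y.
Proof. by move=> linL; rewrite addrC -scaleN1r linL scaleN1r addrC. Qed.

Lemma linear_map0 L : linear_map L -> L 0 = 0.
Proof. by move=> linL; rewrite -(subrr (0 : H)) linear_mapB // !subrr. Qed.

Lemma linear_mapD L x y : linear_map L -> L (x + y) = L x + L y.
Proof. by move=> linL; rewrite -[x]scale1r linL !scale1r. Qed.

Lemma linear_mapZ L a x : linear_map L -> L (a *: x) = a *: L x.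
Proof. by move=> linL; rewrite -[_ *: x]addr0 linL linear_map0 // addr0. Qed.

Lemma linear_map_add L L' : linear_map L -> linear_map L' ->
  linear_map (fun x => L x + L' x).
Proof. by move=> linL linL' a x y; rewrite linL linL' scalerDr addrACA. Qed.

Lemma linear_map_opp L : linear_map L -> linear_map (fun x => - L x).
Proof. by move=> linL a x y; rewrite linL opprD scalerN. Qed.

Lemma linear_map_comp L L' : linear_map L -> linear_map L' ->
  linear_map (fun x => L (L' x)).
Proof. by move=> linL linL' a x y; rewrite linL' linL. Qed.

Lemma finite_rank_comp Z F L :
  linear_map L -> finite_rank Z F -> finite_rank Z (fun x => F (L x)).
Proof.
move=> linL; elim: F / => [|F f t _ IH linf Zt]; first exact: finite_rank0.
apply: (finite_rankD1 (f := f \o L)) => // a x y /=.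
by rewrite linL linf.
Qed.

Lemma finite_rank_map Z Z' F L : linear_map L -> (forall z, Z z -> Z' (L z)) ->
  finite_rank Z F -> finite_rank Z' (fun x => L (F x)).
Proof.
move=> linL LZ; elim: F / => [|F f t _ IH linf Zt].
  by rewrite (linear_map0 linL); exact: finite_rank0.
under eq_fun do rewrite linear_mapD // linear_mapZ //.
by apply: finite_rankD1 => //; exact: LZ.
Qed.

Lemma finite_rankD Z F L : finite_rank Z F -> finite_rank Z L ->
  finite_rank Z (fun x => F x + L x).
Proof.
move=> rF; elim: L / => [|L f t _ IH linf Zt]; first by under eq_fun do rewrite addr0.
by under eq_fun do rewrite addrA; exact: finite_rankD1.
Qed.

Lemma finite_rankN Z F : linear_subspace Z -> finite_rank Z F -> finite_rank Z (fun x => - F x).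
Proof.
move=> sZ; apply: (finite_rank_map (L := -%R)) => [a x y|z Zz].
  by rewrite opprD scalerN.
by rewrite -[- z]sub0r; apply: subspaceB => //; exact: sZ.1.
Qed.

Lemma linear_map_finite_rank Z F : finite_rank Z F -> linear_map F.
Proof.
elim: F / => [|F f t _ IH linf Zt] a x y; first by rewrite scaler0 addr0.
by rewrite IH linf scalerDl -scalerA addrACA -scalerDr.
Qed.

Lemma fredholm_dims_bijective Y Z T : linear_on Y Z T ->
  (forall x, Y x -> T x = 0 -> x = 0) -> (forall z, Z z -> exists2 x, Y x & T x = z) ->
  fredholm_dims Y Z T 0 0.
Proof.
move=> linT injT surjT; split; apply/dim_mod0P.
  by move=> x [Yx Tx]; exact: injT.
by move=> z /surjT[x Yx <-]; exists x.
Qed.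

Lemma fredholm_dims_comp_bijective Y Z T W a b : linear_subspace Y -> linear_subspace Z ->
  linear_on Y Z T -> linear_on Z Z W ->
  (forall z, Z z -> W z = 0 -> z = 0) -> (forall z, Z z -> exists2 x, Z x & W x = z) ->
  fredholm_dims Y Z T a b -> fredholm_dims Y Z (fun x => W (T x)) a b.
Proof.
move=> sY sZ linT linW injW surjW [da db]; split.
  suff -> : ker_on Y (fun x => W (T x)) = ker_on Y T by [].
  rewrite eqEsubset; split=> [x [Yx /injW WTx]|x [Yx Tx]].
    by split=> //; apply: WTx; exact: linT.1.
  by split=> //; rewrite Tx; exact: linear_on0 linW.
have linWT : linear_on Y Z (fun x => W (T x)).
  split=> [x Yx|c x y Yx Yy]; first by apply/linW.1/linT.1.
  by rewrite linT.2 // linW.2 //; exact: linT.1.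
apply: (dim_mod_transfer (T := W) _ _ _ _ _ db) => //.
- exact: (subspace_image sY linWT).
- move=> z Zz; split=> [[x Yx WTx]|[x Yx <-]]; last by exists x.
  have ZTx := linT.1 _ Yx.
  exists x => //; apply/eqP; rewrite -subr_eq0; apply/eqP/injW; first exact: subspaceB.
  by rewrite (linear_onB sZ linW) // WTx subrr.
- move=> z /surjW[x Zx <-]; exists x => //; rewrite subrr.
  exact: (subspace_image sY linWT).1.
Qed.

End FiniteRank.

(** * Geometry of a Hilbert space *)

Section HilbertSpace.
Context {R : realType} {H : hilbertType R}.
Implicit Types (x y z u v : H) (Y Z : set H).
Local Open Scope complex_scope.

Lemma hnormE x : `|x| = (hnorm x)%:C.
Proof. by rewrite /hnorm RRe_real // normr_real. Qed.

Lemma hnorm_ge0 x : 0 <= hnorm x.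
Proof. by rewrite -lecR -hnormE; exact: normr_ge0. Qed.

Lemma hnorm0 : hnorm (0 : H) = 0.
Proof. by rewrite /hnorm normr0. Qed.

Lemma hnorm0_eq0 x : hnorm x = 0 -> x = 0.
Proof. by move=> x0; apply: normr0_eq0; rewrite hnormE x0. Qed.

Lemma hnormD x y : hnorm (x + y) <= hnorm x + hnorm y.
Proof. by rewrite -lecR rmorphD /= -!hnormE ler_normD. Qed.

Lemma hnormN x : hnorm (- x) = hnorm x.
Proof. by rewrite /hnorm normrN. Qed.

Lemma hnormB x y : hnorm (x - y) <= hnorm x + hnorm y.
Proof. by rewrite -(hnormN y) hnormD. Qed.

Lemma hdistC x y : hnorm (x - y) = hnorm (y - x).
Proof. by rewrite -hnormN opprB. Qed.

Lemma hdist_triangle z x y : hnorm (x - y) <= hnorm (x - z) + hnorm (z - y).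
Proof. by rewrite -[x - y](subrKA z) hnormD. Qed.

Lemma hnormZ (r : R) x : hnorm (r%:C *: x) = `|r| * hnorm x.
Proof.
apply: complexI; rewrite rmorphM /= -!hnormE normrZ; congr (_ * _).
by rewrite normc_def /= expr0n addr0 sqrtr_sqr.
Qed.

Lemma hdotxx x : hdot x x = (hnorm x ^+ 2)%:C.
Proof. by rewrite rmorphXn /= -hnormE hdot_norm. Qed.

Lemma hdotDl x y z : hdot (x + y) z = hdot x z + hdot y z.
Proof. exact: linearDl. Qed.

Lemma hdotBl x y z : hdot (x - y) z = hdot x z - hdot y z.
Proof. exact: linearBl. Qed.

Lemma hdotZl (a : R[i]) x z : hdot (a *: x) z = a * hdot x z.
Proof. exact: linearZl_LR. Qed.

Lemma hdot0l z : hdot 0 z = 0.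
Proof. exact: linear0l. Qed.

Lemma hdotDr x y z : hdot z (x + y) = hdot z x + hdot z y.
Proof. exact: linearDr. Qed.

Lemma hdotZr (a : R[i]) x z : hdot z (a *: x) = Num.conj a * hdot z x.
Proof. exact: linearZr_LR. Qed.

Lemma hdotC x y : hdot x y = Num.conj (hdot y x).
Proof. by rewrite hermC mul1r. Qed.

Lemma hdot_eq0C x y : hdot x y = 0 -> hdot y x = 0.
Proof. by move=> xy0; rewrite hdotC xy0 rmorph0. Qed.

Lemma hdotNr x z : hdot z (- x) = - hdot z x.
Proof. exact: linearNr. Qed.

Lemma pythagoras x y : hdot x y = 0 -> hnorm (x + y) ^+ 2 = hnorm x ^+ 2 + hnorm y ^+ 2.
Proof.
move=> xy0; apply: complexI; rewrite rmorphD /= -!hdotxx.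
by rewrite !hdotDl !hdotDr xy0 (hdot_eq0C xy0) addr0 add0r.
Qed.

Lemma parallelogram x y :
  hnorm (x + y) ^+ 2 + hnorm (x - y) ^+ 2 =
    (hnorm x ^+ 2 + hnorm y ^+ 2) *+ 2.
Proof.
apply: complexI; rewrite rmorphMn !rmorphD /= -!hdotxx.
rewrite hdotBl hdotDl !hdotDr !hdotNr; ring.
Qed.

(** The norm of [H] is complex-valued; this form of completeness, with an explicit
    Cauchy modulus [e], speaks of real distances only. *)
Lemma hilbert_complete (u : nat -> H) (e : nat -> R) :
  (forall n m, (n <= m)%N -> hnorm (u m - u n) <= e n) ->
  (forall d, 0 < d -> exists n, e n < d) ->
  exists l, forall d, 0 < d -> exists n, e n < d /\ hnorm (u n - l) < d.
Proof.
move=> uC e0.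
have /cauchy_cvgP u_cvg : cauchy (u @ \oo).
  apply: cauchy_exP => d; rewrite ltcE /= => /andP[/eqP dI d0].
  have [n en] := e0 _ d0; exists (u n); exists n => // m /= nm.
  rewrite -ball_normE /ball_ /= -[d]RRe_real; last first.
    by apply/complex_realP; exists (complex.Re d); case: d dI {d0 en} => a b /= ->.
  by rewrite hnormE ltcR hdistC (le_lt_trans (uC _ _ nm)).
exists (lim (u @ \oo)) => d d0; have [n en] := e0 _ d0.
have /cvgrPdist_lt/(_ (d - e n)%:C) := u_cvg.
rewrite ltcR subr_gt0 => /(_ en)[m _ /(_ (maxn m n)) /=].
rewrite leq_maxl hnormE ltcR => /(_ isT) ul.
exists n; split=> //; apply: le_lt_trans (hdist_triangle (u (maxn m n)) _ _) _.
by rewrite hdistC addrC (hdistC (u _) (lim _)) -ltrBrDr; apply: lt_le_trans ul _;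
  rewrite lerB // uC // leq_maxr.
Qed.

Lemma closed_approx Y x : closed Y ->
  (forall d, 0 < d -> exists2 y, Y y & hnorm (x - y) < d) -> Y x.
Proof.
move=> cY Yx; apply: cY => B /nbhs_ballP[d /=]; rewrite ltcE /= => /andP[/eqP dI d0].
have [y Yy xy] := Yx _ d0; move=> /(_ y) dB; exists y; split=> //; apply: dB.
rewrite -ball_normE /ball_ /= -[d]RRe_real; last first.
  by apply/complex_realP; exists (complex.Re d); case: d dI {d0 xy} => a b /= ->.
by rewrite hnormE ltcR.
Qed.

Lemma approx_closed Y :
  (forall x, (forall d, 0 < d -> exists2 y, Y y & hnorm (x - y) < d) -> Y x) ->
  closed Y.
Proof.
move=> Yx x clx; apply: Yx => d d0.
have [|y [Yy]] := clx (ball x d%:C); first by apply: nbhsx_ballx; rewrite ltcR.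
by rewrite -ball_normE /ball_ /= hnormE ltcR; exists y.
Qed.

End HilbertSpace.

(** * Orthogonal projections *)

Section Projections.
Context {R : realType} {H : hilbertType R}.
Implicit Types (x y z u v : H) (Y Z : set H).
Local Open Scope complex_scope.

(** The conclusion of the projection theorem.  It is separated from closedness
    because it is proved directly, by Gram-Schmidt, for spans of finitely many
    vectors. *)
Definition projectable Y : Prop :=
  forall x, exists y, Y y /\ forall z, Y z -> hdot (x - y) z = 0.

Lemma hdot_coef x z : z != 0 -> hdot (x - (hdot x z / hdot z z) *: z) z = 0.
Proof.
move=> z0; rewrite hdotBl hdotZl divfK ?subrr // hdotxx.
apply: contra_neq z0 => /complexI/eqP; rewrite sqrf_eq0 => /eqP.
exact: hnorm0_eq0.
Qed.

(** Otherwise moving from [y] along [z] by the coefficient [t] of [x - y] on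
    [z] would shorten the distance, by Pythagoras. *)
Lemma minimizer_orthogonal Y x y : linear_subspace Y -> Y y ->
  (forall z, Y z -> hnorm (x - y) ^+ 2 <= hnorm (x - z) ^+ 2) ->
  forall z, Y z -> hdot (x - y) z = 0.
Proof.
move=> sY Yy ymin z Yz; have [->|z0] := eqVneq z 0.
  by apply: hdot_eq0C; rewrite hdot0l.
set t := hdot (x - y) z / hdot z z.
have wz := hdot_coef (x - y) z0; rewrite -/t in wz.
have pyth : hnorm (x - y) ^+ 2 = hnorm (x - y - t *: z) ^+ 2 + hnorm (t *: z) ^+ 2.
  rewrite -pythagoras ?subrK //.
  by apply: hdot_eq0C; rewrite hdotZl (hdot_eq0C wz) mulr0.
have tz0 : t *: z = 0.
  have /ymin : Y (t *: z + y) by exact: sY.2.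
  rewrite pyth [t *: z + y]addrC opprD addrA -lerBrDl subrr.
  by rewrite -[_ <= 0]andbT -(sqr_ge0 (hnorm (t *: z))) -eq_le sqrf_eq0 => /eqP/hnorm0_eq0.
move/eqP: tz0; rewrite scaler_eq0 (negPf z0) orbF => /eqP t0.
by rewrite t0 scale0r subr0 in wz.
Qed.

(** The projection theorem: by the parallelogram identity a minimizing sequence
    for the distance from [x] to [Y] is Cauchy, and a minimizer is an orthogonal
    projection. *)
Lemma closed_projectable Y : closed_subspace Y -> projectable Y.
Proof.
move=> [Y0 linY cY] x; have sY : linear_subspace Y by split.
pose D : set R := [set hnorm (x - y) ^+ 2 | y in Y].
have D_inf : has_inf D.
  split; first by exists (hnorm (x - 0) ^+ 2); exists 0.
  by exists 0 => _ [y _ <-]; exact: sqr_ge0.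
pose d := inf D.
have d_le y : Y y -> d <= hnorm (x - y) ^+ 2.
  by move=> Yy; apply: ge_inf; [exact: D_inf.2 | exists y].
have d_ge0 : 0 <= d by apply: lb_le_inf; [exact: D_inf.1 | move=> _ [y _ <-]; exact: sqr_ge0].
pose e n : R := n.+1%:R^-1.
have e_gt0 n : 0 < e n by rewrite invr_gt0 ltr0n.
have e_le n m : (n <= m)%N -> e m <= e n by move=> nm; rewrite lef_pV2 ?posrE ?ltr0n // ler_nat.
have /choice[u uP] n : exists y, Y y /\ hnorm (x - y) ^+ 2 < d + e n ^+ 2.
  have [_ [y Yy <-] yd] := inf_adherent (exprn_gt0 2 (e_gt0 n)) D_inf.
  by exists y.
have [n m nm|r r0|l ul] := @hilbert_complete _ _ u (fun n => 2 * e n).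
- rewrite -ler_sqr ?nnegrE ?hnorm_ge0 ?mulr_ge0 ?ltW //.
  have := parallelogram (x - u n) (x - u m).
  rewrite [X in _ + hnorm X ^+ 2 = _](_ : _ = u m - u n); last first.
    by rewrite opprB addrC subrKA.
  have mid : Y (2^-1%:C *: (u n + u m)).
    by apply: subspaceZ => //; apply: subspaceD => //; exact: (uP _).1.
  have -> : x - u n + (x - u m) = 2%:C *: (x - 2^-1%:C *: (u n + u m)).
    rewrite scalerBr scalerA -rmorphM /= divff ?pnatr_eq0 // scale1r.
    by rewrite rmorph_nat scaler_nat mulr2n opprD addrACA.
  rewrite hnormZ normr_nat; have := d_le _ mid; have := (uP n).2; have := (uP m).2.
  have := e_le _ _ nm; have := e_gt0 m; have := e_gt0 n.
  set a := hnorm _; set b := hnorm (x - u m); set c := hnorm (x - u n); set g := hnorm _.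
  move=> *; have : e m ^+ 2 <= e n ^+ 2.
    by rewrite ler_sqr ?nnegrE ?(ltW (e_gt0 _)).
  rewrite -mulr_natr !exprMn; lra.
- have [n nr] : exists n, (r / 2)^-1 < n.+1%:R.
    by exists (Num.truncn (r / 2)^-1); rewrite truncnS_gt.
  exists n; rewrite mulrC -ltr_pdivlMr //.
  by rewrite -[ltRHS]invrK ltf_pV2 ?posrE ?invr_gt0 ?divr_gt0 ?ltr0n.
exists l; have Yl : Y l.
  apply: closed_approx => // r /ul[n [_ unl]]; exists (u n); first exact: (uP n).1.
  by rewrite hdistC.
split=> //; apply: minimizer_orthogonal => // z /d_le; apply: le_trans.
rewrite leNgt; apply/negP; set s := hnorm _ => ds.
have s_gt0 : 0 < s.
  rewrite lt_def hnorm_ge0 andbT; apply/eqP => s0.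
  by move: ds; rewrite s0 expr0n ltNge d_ge0.
(* [4 s r = s^2 - d], while an approximant at distance below [r] from [l]
   gives [(s - r)^2 < d + r^2], that is, [s^2 - d < 2 s r]: a contradiction. *)
pose r := (s ^+ 2 - d) / (4 * s).
have rs : r * (4 * s) = s ^+ 2 - d by rewrite divfK // mulf_neq0 ?gt_eqF.
have r_gt0 : 0 < r by rewrite divr_gt0 ?subr_gt0 ?mulr_gt0.
have [n [enr unl]] := ul _ r_gt0.
have := (uP n).2; have := hdist_triangle (u n) x l; rewrite -/s.
have := hnorm_ge0 (x - u n); have := e_gt0 n; set a := hnorm (x - u n) => en a0 sa au.
have rle : r <= s.
  by rewrite -(ler_pM2r (x := 4 * s)) ?mulr_gt0 // rs; nra.
have : (s - r) ^+ 2 <= a ^+ 2 by rewrite ler_sqr ?nnegrE ?subr_ge0 //; lra.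
have : e n ^+ 2 <= r ^+ 2 by rewrite ler_sqr ?nnegrE ?(ltW en) ?(ltW r_gt0) //; lra.
nra.
Qed.

Section OneProjection.
Variable Y : set H.
Hypotheses (sY : linear_subspace Y) (pY : projectable Y).

Lemma projP x : Y (proj Y x) /\ forall z, Y z -> hdot (x - proj Y x) z = 0.
Proof.
rewrite /proj; case: xgetP => [y _ //|nY].
by have [y yP] := pY x; case: (nY y).
Qed.

Lemma projY x : Y (proj Y x). Proof. by case: (projP x). Qed.

Lemma proj_orth x z : Y z -> hdot (x - proj Y x) z = 0.
Proof. by case: (projP x) => _; apply. Qed.

Lemma proj_unique x y : Y y -> (forall z, Y z -> hdot (x - y) z = 0) -> proj Y x = y.
Proof.
move=> Yy xy; apply/eqP; rewrite -subr_eq0; apply/eqP/hnorm0_eq0/eqP.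
rewrite -sqrf_eq0; apply/eqP/complexI; rewrite -hdotxx.
have Yd : Y (proj Y x - y) by apply: subspaceB => //; exact: projY.
rewrite -[X in hdot X _](subrKA x) hdotDl xy //.
by rewrite -[_ - x]opprB -scaleN1r hdotZl proj_orth // mulr0 addr0.
Qed.

Lemma proj_id y : Y y -> proj Y y = y.
Proof. by move=> Yy; apply: proj_unique => // z _; rewrite subrr hdot0l. Qed.

Lemma proj_linear (a : R[i]) x y : proj Y (a *: x + y) = a *: proj Y x + proj Y y.
Proof.
apply: proj_unique => [|z Yz]; first by apply: sY.2; exact: projY.
by rewrite opprD addrACA -scalerBr hdotDl hdotZl !proj_orth // mulr0 addr0.
Qed.

Lemma proj_pythagoras x :
  hnorm x ^+ 2 = hnorm (x - proj Y x) ^+ 2 + hnorm (proj Y x) ^+ 2.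
Proof. by rewrite -pythagoras ?subrK // proj_orth //; exact: projY. Qed.

Lemma hnorm_proj x : hnorm (proj Y x) <= hnorm x.
Proof.
rewrite -ler_sqr ?nnegrE ?hnorm_ge0 // [leRHS]proj_pythagoras.
by rewrite lerDr sqr_ge0.
Qed.

Lemma hnorm_subproj x : hnorm (x - proj Y x) <= hnorm x.
Proof.
rewrite -ler_sqr ?nnegrE ?hnorm_ge0 // [leRHS]proj_pythagoras.
by rewrite lerDl sqr_ge0.
Qed.

Lemma proj_dist_le x y : Y y -> hnorm (x - proj Y x) <= hnorm (x - y).
Proof.
move=> Yy; rewrite -ler_sqr ?nnegrE ?hnorm_ge0 //.
have -> : x - y = (x - proj Y x) + (proj Y x - y) by rewrite subrKA.
rewrite (pythagoras (x := x - proj Y x)) ?lerDl ?sqr_ge0 //.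
by apply: proj_orth; apply: subspaceB => //; exact: projY.
Qed.

Lemma range_proj : range (proj Y) = Y.
Proof.
rewrite eqEsubset; split=> [_ [x _ <-]|y Yy]; first exact: projY.
by exists y => //; exact: proj_id.
Qed.

End OneProjection.
End Projections.

(** * Approximation of compact operators by operators of finite rank *)

Section FiniteRankApproximation.
Context {R : realType} {H : hilbertType R}.
Implicit Types (x y z u v : H) (Y Z E : set H) (T K G : H -> H).
Local Open Scope complex_scope.

(** Gram-Schmidt: each step adds to [E] the part [v] of the new vector that is
    orthogonal to [E], and adds to the projection the rank-one operator
    [x |-> (hdot x v / hdot v v) *: v]. *)
Lemma span_projectable Z (s : seq H) : linear_subspace Z -> (forall t, t \in s -> Z t) ->
  exists E, [/\ linear_subspace E, projectable E, forall t, t \in s -> E t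
              & finite_rank Z (proj E)].
Proof.
move=> sZ; elim: s => [|t s IH] sZs.
  have s0 := @subspace0 R[i] H.
  have p0 : @projectable R H [set 0].
    move=> x; exists 0; split=> // z ->.
    by apply: hdot_eq0C; rewrite hdot0l.
  exists [set 0]; split=> //.
  suff -> : proj [set 0 : H] = fun=> 0 by exact: finite_rank0.
  by apply/funext => x; exact: (projY p0 x).
have [|E [sE pE Es rE]] := IH; first by move=> u us; apply: sZs; rewrite inE us orbT.
have rangeE x : Z (proj E x).
  elim: (proj E) / rE => [|F f u _ IHF _ Zu]; first exact: sZ.1.
  by apply: subspaceD => //; exact: subspaceZ.
pose v := t - proj E t.
have Ev z : E z -> hdot v z = 0 by move=> Ez; exact: proj_orth.
have [v0|v0] := eqVneq v 0.
  exists E; split=> // u; rewrite inE => /orP[/eqP->|/Es//].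
  by move/eqP: v0; rewrite subr_eq0 => /eqP ->; exact: projY.
pose p x := proj E x + (hdot x v / hdot v v) *: v.
have sE' := subspace_add_line v sE.
have Ep x : add_line E v (p x).
  by exists (hdot x v / hdot v v); rewrite addrK; exact: projY.
have Orth x z : add_line E v z -> hdot (x - p x) z = 0.
  move=> [c Ez]; rewrite -[z](subrK (c *: v)) hdotDr hdotZr.
  have -> : hdot (x - p x) v = 0.
    rewrite /p opprD addrA addrAC hdotBl hdot_coef // hdot_eq0C ?subrr //.
    by apply: Ev; exact: projY.
  rewrite mulr0 addr0 opprD addrA hdotBl proj_orth // sub0r hdotZl (Ev _ Ez).
  by rewrite mulr0 oppr0.
have pE' : projectable (add_line E v).
  by move=> x; exists (p x); split; [exact: Ep | exact: Orth].
have pEE x : proj (add_line E v) x = p x by apply: proj_unique => //; exact: Orth.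
exists (add_line E v); split=> //.
  move=> u; rewrite inE => /orP[/eqP->|/Es Eu]; last exact: add_line_sub.
  by exists 1; rewrite scale1r /v subKr; exact: projY.
rewrite (_ : proj _ = p); last exact/funext.
apply: finite_rankD1 => //.
  by move=> a x y; rewrite hdotDl hdotZl mulrDl mulrA.
by apply: subspaceB => //; apply: sZs; rewrite mem_head.
Qed.

Lemma totally_bounded (A : set H) (d : R) : precompact A -> 0 < d ->
  exists s : seq H, (forall t, t \in s -> A t) /\
    forall x, A x -> exists2 t, t \in s & hnorm (x - t) < d.
Proof.
rewrite precompactE compact_cover => cA d0.
have [t At|x|D DA AD] := cA _ A (fun t => ball t d%:C).
- by apply: ball_open; rewrite ltcR.
- move=> /(_ (ball x d%:C)) [|a [Aa xa]]; first by apply: nbhsx_ballx; rewrite ltcR.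
  by exists a => //; exact: ball_sym.
exists (enum_fset D); split=> [t /DA|x Ax]; first by rewrite inE.
have [t Dt] := AD _ (subset_closure Ax).
rewrite -ball_normE /ball_ /= hnormE ltcR hdistC; by exists t.
Qed.

Lemma unit_ball_bound Y Z T (M : R) : linear_subspace Y -> linear_on Y Z T ->
  (forall x, Y x -> hnorm x <= 1 -> hnorm (T x) <= M) ->
  forall x, Y x -> hnorm (T x) <= M * hnorm x.
Proof.
move=> sY linT TM x Yx; have [x0|x0] := eqVneq (hnorm x) 0.
  by rewrite (hnorm0_eq0 x0) (linear_on0 sY linT) hnorm0 mulr0.
have x_gt0 : 0 < hnorm x by rewrite lt_def x0 hnorm_ge0.
have Yu : Y ((hnorm x)^-1%:C *: x) by exact: subspaceZ.
have := TM _ Yu.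
rewrite hnormZ gtr0_norm ?invr_gt0 // mulVf // lexx => /(_ isT).
rewrite -[_ *: x]addr0 linT.2 //; last exact: sY.1.
rewrite (linear_on0 sY linT) addr0 hnormZ gtr0_norm ?invr_gt0 //.
by rewrite mulrC ler_pdivrMr.
Qed.

(** The image of the unit ball lies within [d] of finitely many of its points;
    projecting onto the span [E] of these points moves it by at most [d]. *)
Lemma compact_approx Y Z K (d : R) : linear_subspace Y -> linear_subspace Z ->
  compact_operator Y Z K -> 0 < d ->
  exists E, [/\ linear_subspace E, projectable E, finite_rank Z (proj E)
    & forall x, Y x -> hnorm (K x - proj E (K x)) <= d * hnorm x].
Proof.
move=> sY sZ [linK cK] d0.
have [s [sK Ks]] := totally_bounded cK d0.
have [|E [sE pE Es rE]] := @span_projectable Z s sZ.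
  by move=> t /sK[x [Yx _] <-]; exact: linK.1.
exists E; split=> //.
apply: (@unit_ball_bound Y setT (fun x => K x - proj E (K x))) => //.
  split=> // a x y Yx Yy.
  by rewrite linK.2 // proj_linear // opprD addrACA -scalerBr.
move=> x Yx x1; have [|t st Kxt] := Ks (K x); first by exists x.
apply: le_trans (ltW Kxt); apply: proj_dist_le => //; exact: Es.
Qed.

Lemma compact_bounded Y Z K : linear_subspace Y -> compact_operator Y Z K ->
  exists M, forall x, Y x -> hnorm (K x) <= M * hnorm x.
Proof.
move=> sY [linK cK]; have [s [_ Ks]] := totally_bounded cK ltr01.
exists (1 + \sum_(t <- s) hnorm t); apply: (unit_ball_bound sY linK) => x Yx x1.
have [|t st Kxt] := Ks (K x); first by exists x.
rewrite -[K x](subrK t); apply: le_trans (hnormD _ _) _; apply: lerD; first exact: ltW.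
rewrite (big_rem t) //= lerDl; apply: sumr_ge0 => u _; exact: hnorm_ge0.
Qed.

(** The a priori bound [M] is needed because [op_norm], a supremum of reals,
    has a default value on unbounded sets. *)
Lemma op_norm_bound Y Z T M : linear_subspace Y -> linear_on Y Z T ->
  (forall x, Y x -> hnorm (T x) <= M * hnorm x) ->
  forall x, Y x -> hnorm (T x) <= op_norm Y T * hnorm x.
Proof.
move=> sY linT TM; apply: (unit_ball_bound sY linT) => x Yx x1.
apply: ub_le_sup; last by exists x.
exists `|M| => _ [y [Yy y1] <-]; apply: le_trans (TM _ Yy) _.
apply: le_trans (ler_wpM2r (hnorm_ge0 y) (ler_norm M)) _.
by rewrite -[leRHS]mulr1 ler_wpM2l.
Qed.

Lemma op_norm_ge0 Y T : 0 <= op_norm Y T.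
Proof.
rewrite /op_norm; set A := (X in sup X).
have [[[r Ar] A_ub]|/sup_out->//] := pselect (has_sup A).
by apply: le_trans (ub_le_sup A_ub Ar); case: Ar => x _ <-; exact: hnorm_ge0.
Qed.

Lemma compact_operator0 Y Z : linear_subspace Y -> linear_subspace Z ->
  compact_operator Y Z (fun=> 0).
Proof.
move=> sY sZ; split; first by split=> [x _|a x y _ _]; [exact: sZ.1 | rewrite scaler0 addr0].
apply: (@precompact_subset _ _ [set 0]).
  by move=> _ [x _ <-].
rewrite precompact_closed; first exact: compact_set1.
apply: accessible_closed_set1; exact/hausdorff_accessible/norm_hausdorff.
Qed.

Lemma calkin_norm_ge0 Y Z T : linear_subspace Y -> linear_subspace Z -> 0 <= calkin_norm Y Z T.
Proof.
move=> sY sZ; apply: lb_le_inf.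
  by exists (op_norm Y (fun x => T x + 0)), (fun=> 0) => //; exact: compact_operator0.
by move=> _ [K _ <-]; exact: op_norm_ge0.
Qed.

(** A compact [K] brings the norm of [G + K] below [c]; splitting [K] into a
    finite-rank part and a part of norm at most the remaining margin gives [h]
    as [G] plus the finite-rank part. *)
Lemma calkin_approx Y Z G (c : R) : linear_subspace Y -> projectable Y -> linear_subspace Z ->
  bounded_operator Y Z G -> calkin_norm Y Z G < c ->
  exists h, [/\ linear_map h, forall x, hnorm (h x) <= c * hnorm x
    & finite_rank Z (fun x => G (proj Y x) - h x)].
Proof.
move=> sY pY sZ [linG [M GM]].
pose C : set R := [set op_norm Y (fun x => G x + K x) | K in compact_operator Y Z].
have C_inf : has_inf C.
  split; first by exists (op_norm Y (fun x => G x + 0)), (fun=> 0) => //; exact: compact_operator0.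
  by exists 0 => _ [K _ <-]; exact: op_norm_ge0.
move=> /(inf_lt C_inf.1)[_ [K cK <-]] lt_c; set N := op_norm _ _ in lt_c.
have linK := cK.1.
have linGK : linear_on Y Z (fun x => G x + K x).
  split=> [x Yx|a x y Yx Yy].
    by apply: subspaceD => //; [exact: linG.1 | exact: linK.1].
  by rewrite linG.2 // linK.2 // scalerDr addrACA.
have [M' KM'] := compact_bounded sY cK.
have GKN : forall x, Y x -> hnorm (G x + K x) <= N * hnorm x.
  apply: (op_norm_bound (M := M + M') sY linGK) => x Yx.
  by apply: le_trans (hnormD _ _) _; rewrite mulrDl lerD ?GM ?KM'.
have [|E [sE pE rE EK]] := compact_approx (d := c - N) sY sZ cK; first by rewrite subr_gt0.
have linP := proj_linear sY pY; have linPE := proj_linear sE pE.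
have linKP : linear_map (fun x => K (proj Y x)).
  by move=> a x y; rewrite linP linK.2 //; exact: projY.
exists (fun x => G (proj Y x) + proj E (K (proj Y x))); split.
- move=> a x y; rewrite linP linG.2 ?linK.2 ?linPE ?scalerDr; try exact: projY.
  by rewrite addrACA.
- move=> x; have Yx := projY pY x.
  apply: (@le_trans _ _ (c * hnorm (proj Y x))); last first.
    apply: ler_wpM2l; last exact: hnorm_proj.
    by apply: ltW; apply: le_lt_trans lt_c; exact: op_norm_ge0.
  set y := proj Y x in Yx *.
  have -> : G y + proj E (K y) = (G y + K y) - (K y - proj E (K y)).
      by rewrite opprB addrACA subrr addr0.
  apply: le_trans (hnormB _ _) _.
  by rewrite -[c](subrKC N) mulrDl lerD ?GKN ?EK.
- under eq_fun do rewrite opprD addrA subrr sub0r.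
  apply: finite_rankN => //; exact: (finite_rank_comp linKP rE).
Qed.

End FiniteRankApproximation.

(** * Neumann series *)

Section Neumann.
Context {R : realType} {H : hilbertType R}.
Implicit Types (x y z : H) (N : H -> H).

(** The iterates of [x |-> y - N x] converge geometrically. *)
Lemma neumann_solution N (q : R) y : linear_map N -> 0 <= q < 1 ->
  (forall x, hnorm (N x) <= q * hnorm x) -> exists x, x + N x = y.
Proof.
move=> linN /andP[q0 q1] Nq.
pose u n := iter n (fun x => y - N x) 0.
have uS n : u n.+1 = y - N (u n) by [].
have step n : hnorm (u n.+1 - u n) <= q ^+ n * hnorm y.
  elim: n => [|n IH].
    by rewrite uS /u /= linear_map0 // !subr0 mul1r.
  have -> : u n.+2 - u n.+1 = N (u n - u n.+1).
    by rewrite (linear_mapB _ _ linN) (uS n.+1) {2}(uS n) opprB addrC subrKA.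
  apply: le_trans (Nq _) _.
  by rewrite exprS -mulrA ler_wpM2l // hdistC.
have r_gt0 : 0 < 1 - q by rewrite subr_gt0.
pose C := (1 - q)^-1 * hnorm y.
have C_ge0 : 0 <= C by rewrite mulr_ge0 ?hnorm_ge0 ?invr_ge0 ?ltW.
have yC : hnorm y = (1 - q) * C by rewrite mulrA divff ?gt_eqF // mul1r.
have qn_ge0 n : 0 <= q ^+ n by exact: exprn_ge0.
have dist n k : hnorm (u (n + k)%N - u n) <= (q ^+ n - q ^+ (n + k)) * C.
  elim: k => [|k IH]; first by rewrite addn0 !subrr mul0r hnorm0.
  apply: le_trans (hdist_triangle (u (n + k)%N) _ _) _.
  have := step (n + k)%N; rewrite addnS yC exprS; lra.
have [n m nm|d d0|l ul] := @hilbert_complete _ _ u (fun n => q ^+ n * C).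
- rewrite -(subnKC nm); apply: le_trans (dist _ _) _.
  by rewrite ler_wpM2r // gerBl.
- have q_lt1 : `|q| < 1 by rewrite ger0_norm.
  have /cvgrPdist_lt/(_ d d0)[n _ /(_ n (leqnn n))] := cvg_geometric C q_lt1.
  rewrite /geometric /= sub0r normrN mulrC (ger0_norm (mulr_ge0 (qn_ge0 n) C_ge0)) => nd.
  by exists n.
exists l; apply/eqP; rewrite -subr_eq0; apply/eqP/hnorm0_eq0.
apply/eqP; rewrite eq_le hnorm_ge0 andbT leNgt; apply/negP => s_gt0.
set s := hnorm _ in s_gt0; have [|n [en unl]] := ul (s / 3); first by rewrite divr_gt0.
have sE : l + N l - y = (l - u n) + N (l - u n) - (u n.+1 - u n).
  rewrite uS (linear_mapB _ _ linN); set a := N l; set b := N (u n).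
  by rewrite [in RHS]addrACA -opprD -[y - b - _]addrA -opprD opprB [b + _]addrC addrA subrK.
have : s <= hnorm (l - u n) + q * hnorm (l - u n) + q ^+ n * ((1 - q) * C).
  rewrite /s sE; apply: le_trans (hnormB _ _) _; apply: lerD; last by rewrite -yC.
  by apply: le_trans (hnormD _ _) _; rewrite lerD2l.
have qC : 0 <= q * (q ^+ n * C) by rewrite mulr_ge0 // mulr_ge0.
have : q * hnorm (l - u n) <= hnorm (l - u n) by rewrite ler_piMl ?hnorm_ge0 ?ltW.
rewrite (hdistC l); lra.
Qed.

Lemma neumann N (q : R) : linear_map N -> 0 <= q < 1 ->
  (forall x, hnorm (N x) <= q * hnorm x) ->
  exists V, [/\ linear_map V, forall x, V x + N (V x) = x,
    forall x, x + N x = 0 -> x = 0 & forall x, hnorm (V x) <= (1 - q)^-1 * hnorm x].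
Proof.
move=> linN q01 Nq; have /andP[q0 q1] := q01.
have r_gt0 : 0 < 1 - q by rewrite subr_gt0.
have lower x : (1 - q) * hnorm x <= hnorm (x + N x).
  have := hnormB (x + N x) (N x); rewrite addrK; have := Nq x; lra.
have inj x : x + N x = 0 -> x = 0.
  move=> x0; apply: hnorm0_eq0; apply/eqP; rewrite eq_le hnorm_ge0 andbT.
  by rewrite -(ler_pM2l r_gt0) mulr0 -(hnorm0 (H := H)) -x0.
have /choice[V VP] y : exists x, x + N x = y := neumann_solution y linN q01 Nq.
exists V; split=> // [a x y|x].
  apply/eqP; rewrite -subr_eq0; apply/eqP/inj.
  rewrite (linear_mapB _ _ linN) linN addrACA -opprD VP addrACA -scalerDr !VP.
  by rewrite subrr.
by rewrite ler_pdivlMl //; apply: le_trans (lower _) _; rewrite VP.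
Qed.

End Neumann.

(** * Orthogonal decompositions and graphs *)

Section Decomposition.
Context {R : realType} {H : hilbertType R}.
Implicit Types (x y z u v : H) (Y Z : set H) (T F N K G : H -> H).

Lemma closed_subspace_subspace Y : closed_subspace Y -> linear_subspace Y.
Proof. by case. Qed.

(** A Lipschitz map that vanishes on a set vanishes on its closure; graphs and
    orthogonal complements are recognized as closed by means of such maps. *)
Lemma closed_kernel T (M : R) : linear_map T -> (forall x, hnorm (T x) <= M * hnorm x) ->
  closed_subspace [set x | T x = 0].
Proof.
move=> linT TM; split; first exact: linear_map0.
  by move=> a x y /= Tx Ty; rewrite linT Tx Ty scaler0 addr0.
apply: approx_closed => x xT /=; apply: hnorm0_eq0; apply/eqP.
rewrite eq_le hnorm_ge0 andbT leNgt; apply/negP => Tx_gt0.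
have M_gt0 : 0 < `|M| + 1 by rewrite ltr_wpDl.
have [|y /= Ty xy] := xT (hnorm (T x) / (`|M| + 1)); first by rewrite divr_gt0.
have := TM (x - y); rewrite (linear_mapB _ _ linT) Ty subr0 leNgt => /negP; apply.
move: xy; rewrite ltr_pdivlMr // mulrC; apply: le_lt_trans.
by rewrite ler_wpM2r ?hnorm_ge0 // (le_trans (ler_norm M)) // lerDl.
Qed.

Lemma is_projection_compl Y : closed_subspace Y -> is_projection (fun x => x - proj Y x).
Proof.
move=> cY; have pY := closed_projectable cY; have sY := closed_subspace_subspace cY.
have linP := proj_linear sY pY.
have cK : closed_subspace [set x | proj Y x = 0].
  by apply: (closed_kernel (M := 1) linP) => x; rewrite mul1r; exact: hnorm_proj.
exists [set x | proj Y x = 0] => //; apply/funext => x; apply/esym/proj_unique.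
- exact: closed_subspace_subspace.
- exact: closed_projectable.
- by rewrite /= (linear_mapB _ _ linP) [X in _ - X]proj_id ?subrr //; exact: projY.
- move=> z /= z0; rewrite subKr -[z]subr0 -z0; apply: hdot_eq0C.
  by apply: proj_orth => //; exact: projY.
Qed.

Section OneDecomposition.
Variables Y Z : set H.
Hypothesis YZ : orthogonal_decomposition Y Z.

Lemma decomp_subspace : linear_subspace Y /\ linear_subspace Z.
Proof. by case: YZ => cY cZ _ _; split; exact: closed_subspace_subspace. Qed.

Let sY := decomp_subspace.1.
Let sZ := decomp_subspace.2.

Lemma decomp_projectable : projectable Y.
Proof. by case: YZ => cY _ _ _; exact: closed_projectable. Qed.

Let pY := decomp_projectable.

Lemma decomp_proj x : Z (x - proj Y x).
Proof.
case: YZ => _ _ orthYZ /(_ x)[y [z [Yy Zz ->]]].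
have -> : proj Y (y + z) = y; last by rewrite addrC addKr.
apply: proj_unique => // u Yu; rewrite addrC addKr.
by apply: hdot_eq0C; exact: orthYZ.
Qed.

Lemma decomp_proj0 z : Z z -> proj Y z = 0.
Proof.
case: YZ => _ _ orthYZ _ Zz; apply: proj_unique => // [|u Yu]; first exact: sY.1.
by rewrite subr0; apply: hdot_eq0C; exact: orthYZ.
Qed.

Lemma range_decomp_compl : range (fun x => x - proj Y x) = Z.
Proof.
rewrite eqEsubset; split=> [_ [x _ <-]|z Zz]; first exact: decomp_proj.
by exists z => //; rewrite decomp_proj0 // subr0.
Qed.

Lemma compl_linear : linear_map (fun x => x - proj Y x).
Proof.
by move=> a x y; rewrite proj_linear // opprD addrACA -scalerBr.
Qed.

(** This map to [Z] vanishes exactly on the graph and is the identity on [Z]: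
    it is the projection onto [Z] along the graph of [G], and realizes the
    quotient of the whole space by the graph. *)
Definition graph_defect G v := v - proj Y v - G (proj Y v).

Variable G : H -> H.
Hypothesis bG : bounded_operator Y Z G.

Let linG := bG.1.

Lemma graph_defect_linear : linear_map (graph_defect G).
Proof.
move=> a x y; rewrite /graph_defect compl_linear proj_linear // linG.2; try exact: projY.
by rewrite opprD addrACA -scalerBr.
Qed.

Lemma graph_defect_in v : Z (graph_defect G v).
Proof.
by apply: subspaceB => //; [exact: decomp_proj | apply: linG.1; exact: projY].
Qed.

Lemma graph_defect_id z : Z z -> graph_defect G z = z.
Proof.
by move=> Zz; rewrite /graph_defect decomp_proj0 // (linear_on0 sY linG) !subr0.
Qed.

Lemma graphE : graph Y G = [set v | graph_defect G v = 0].
Proof.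
rewrite eqEsubset; split=> [_ [y Yy <-]|v /eqP] /=.
  rewrite /graph_defect.
  have -> : proj Y (y + G y) = y.
    rewrite (linear_mapD _ _ (proj_linear sY pY)) proj_id // decomp_proj0 ?addr0 //.
    exact: linG.1.
  by rewrite [y + _]addrC addrK subrr.
rewrite subr_eq0 => /eqP defv; exists (proj Y v); first exact: projY.
by rewrite -defv addrC subrK.
Qed.

Lemma closed_graph : closed_subspace (graph Y G).
Proof.
have [M GM] := bG.2; rewrite graphE; apply: (closed_kernel (M := 1 + `|M|)).
  exact: graph_defect_linear.
move=> x; apply: le_trans (hnormB _ _) _; rewrite mulrDl mul1r lerD ?hnorm_subproj //.
apply: le_trans (GM _ (projY pY x)) _; apply: le_trans (ler_wpM2r _ (ler_norm M)) _.
  exact: hnorm_ge0.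
by rewrite ler_wpM2l ?hnorm_proj.
Qed.

End OneDecomposition.
End Decomposition.

(** * Fredholm perturbation theory on nearly complementary subspaces *)

Section FredholmPerturbation.
Context {R : realType} {H : hilbertType R}.
Implicit Types (x y z u v : H) (Y Z : set H) (T F N K G : H -> H).

Lemma fredholm_dims_ext Y Z T T' a b : (forall x, Y x -> T x = T' x) ->
  fredholm_dims Y Z T a b -> fredholm_dims Y Z T' a b.
Proof.
move=> TT'; rewrite /fredholm_dims.
have -> : ker_on Y T = ker_on Y T'.
  by rewrite eqEsubset; split=> x [Yx]; rewrite ?TT' // => Tx; split=> //; rewrite TT'.
have -> // : T @` Y = T' @` Y.
by rewrite eqEsubset; split=> _ [x Yx <-]; exists x; rewrite ?TT'.
Qed.

(** [N] takes all its values in [Z], so the solutions [x] of [x + N x = z] with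
    [z] in [Z] lie in [Z] too. *)
Lemma neumann_bijective Z N (q : R) : linear_subspace Z -> linear_map N -> 0 <= q < 1 ->
  (forall x, hnorm (N x) <= q * hnorm x) -> (forall x, Z (N x)) ->
  [/\ linear_on Z Z (fun z => z + N z),
      forall z, Z z -> z + N z = 0 -> z = 0
    & forall z, Z z -> exists2 x, Z x & x + N x = z].
Proof.
move=> sZ linN q01 Nq NZ; have [V [_ NV inj _]] := neumann linN q01 Nq.
split=> [|z _|z Zz].
- split=> [z Zz|a x y _ _]; first exact: subspaceD.
  by rewrite linN scalerDr addrACA.
- exact: inj.
- by exists (V z); rewrite ?NV // -[V z](addrK (N (V z))) NV; exact: subspaceB.
Qed.

(** Riesz theory: the identity plus a small operator is bijective, and a term
    of finite rank does not affect the Fredholm property. *)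
Lemma fredholm_dims_near_id Z N F (q : R) : linear_subspace Z -> linear_map N -> 0 <= q < 1 ->
  (forall x, hnorm (N x) <= q * hnorm x) -> (forall z, Z (N z)) -> finite_rank Z F ->
  exists a b, fredholm_dims Z Z (fun z => z + N z + F z) a b.
Proof.
move=> sZ linN q01 Nq NZ rF.
have [linW injW surjW] := neumann_bijective sZ linN q01 Nq NZ.
have d0 := fredholm_dims_bijective linW injW surjW.
by have [a [b [d _]]] := fredholm_dims_finite_rank sZ sZ linW rF d0; exists a, b.
Qed.

(** Calkin norms are infima that need not be attained; this provides the room
    for choosing nearly optimal compact corrections. *)
Lemma lt1_product_margin (p q : R) : 0 <= p -> 0 <= q -> p * q < 1 ->
  exists p' q', [/\ p < p', q < q' & p' * q' < 1].
Proof.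
move=> p0 q0 pq; pose S := p + q + 1; pose d := (1 - p * q) / (2 * S).
have S1 : 1 <= S by rewrite /S; lra.
have dS : d * S * 2 = 1 - p * q.
  by rewrite -mulrA [S * 2]mulrC divfK // mulf_neq0 // gt_eqF // (lt_le_trans ltr01).
have d0 : 0 < d by rewrite divr_gt0 ?subr_gt0 ?mulr_gt0 // (lt_le_trans ltr01).
have pq0 : 0 <= p * q by exact: mulr_ge0.
have d1 : d <= 1 by nra.
exists (p + d), (q + d); split; rewrite ?ltrDl //.
by rewrite /S in dS; nra.
Qed.

Section NearlyComplementary.
Variables Y0 Z0 Y1 Z1 : set H.
Hypotheses (D0 : orthogonal_decomposition Y0 Z0) (D1 : orthogonal_decomposition Y1 Z1).
Let s0 := proj Y0.
Let s1 := proj Y1.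
Let c0 x := x - s0 x.
Let K x := x - s1 x - s0 x.
Hypothesis cK : compact_operator setT setT K.

Let sY0 := (decomp_subspace D0).1.
Let sZ0 := (decomp_subspace D0).2.
Let sY1 := (decomp_subspace D1).1.
Let pY0 := decomp_projectable D0.
Let pY1 := decomp_projectable D1.
Let lin_s0 : linear_map s0 := proj_linear sY0 pY0.
Let lin_s1 : linear_map s1 := proj_linear sY1 pY1.
Let lin_c0 : linear_map c0 := compl_linear D0.
Let s1_in x : Y1 (s1 x) := projY pY1 x.
Let c0_in x : Z0 (c0 x) := decomp_proj D0 x.
Let s1_id x : Y1 x -> s1 x = x. Proof. exact: proj_id. Qed.
Let c0_id z : Z0 z -> c0 z = z.
Proof. by move=> Zz; rewrite /c0 /s0 (decomp_proj0 D0 Zz) subr0. Qed.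
Let s1_le x : hnorm (s1 x) <= hnorm x. Proof. exact: hnorm_proj. Qed.
Let c0_le x : hnorm (c0 x) <= hnorm x. Proof. exact: hnorm_subproj. Qed.

Lemma split_compact (e : R) : 0 < e ->
  exists N F, [/\ linear_map N, finite_rank setT F,
    forall x, hnorm (N x) <= e * hnorm x & forall x, K x = N x + F x].
Proof.
move=> e0; have sT : linear_subspace (setT : set H) by split.
have [E [sE pE rE KE]] := compact_approx sT sT cK e0.
have linK : linear_map K by move=> a x y; exact: cK.1.2.
have linE := proj_linear sE pE.
exists (fun x => K x - proj E (K x)), (fun x => proj E (K x)); split.
- by move=> a x y; rewrite linK linE opprD addrACA -scalerBr.
- exact: (finite_rank_comp linK rE).
- by move=> x; exact: KE.
- by move=> x; rewrite subrK.
Qed.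

Let c0E x : c0 x = s1 x + K x.
Proof. by rewrite /K addrCA addrA subrK. Qed.

Let s1E x : s1 x = c0 x - K x.
Proof. by rewrite c0E addrK. Qed.

Lemma linear_compl : linear_on Y1 Z0 c0.
Proof. by split=> [x _|a x y _ _]; [exact: c0_in | exact: lin_c0]. Qed.

(** [S1] is a two-sided inverse of [c0] modulo compact operators.  Thus the kernel
    of [c0] lies in that of [S1 c0], and its image contains that of [c0 S1], where
    both composites are the identity up to a small and a finite-rank term. *)
Lemma fredholm_complementary : exists a b, fredholm_dims Y1 Z0 c0 a b.
Proof.
have h01 : 0 <= (2^-1 : R) < 1 by apply/andP; split; lra.
have [|N [F [linN rF Ne KE]]] := @split_compact 2^-1; first by rewrite invr_gt0.
have [a [b [da _]]] : exists a b,
    fredholm_dims Y1 Y1 (fun x => x + s1 (N x) + s1 (F x)) a b.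
  apply: (fredholm_dims_near_id (q := 2^-1)) => //.
  - by move=> c x y; rewrite linN lin_s1.
  - by move=> x; apply: le_trans (s1_le _) (Ne x).
  - by apply: finite_rank_map rF => // z _; exact: s1_in.
have [a' [b' [_ db]]] : exists a b,
    fredholm_dims Z0 Z0 (fun z => z + - c0 (N z) + - c0 (F z)) a b.
  apply: (fredholm_dims_near_id (N := fun z => - c0 (N z)) (q := 2^-1)) => //.
  - by move=> c x y; rewrite linN lin_c0 opprD scalerN.
  - by move=> x; rewrite hnormN; apply: le_trans (c0_le _) (Ne x).
  - by move=> z; rewrite -[- _]sub0r; apply: subspaceB => //; exact: sZ0.1.
  - by apply: finite_rankN => //; apply: finite_rank_map rF => // z _; exact: c0_in.
have linc := linear_compl.
have [m dm] : exists m, dim_mod (ker_on Y1 c0) [set 0] m.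
  apply: finite_dim_mod_sub da; first exact: subspace0.
  - by move=> _ ->; exact: (subspace_ker_on sY1 linc).1.
  - move=> x [Yx cx]; split=> //.
    have : s1 (c0 x) = 0 by rewrite cx; exact: linear_map0.
    rewrite c0E KE.
    by rewrite !(linear_mapD _ _ lin_s1) (s1_id (s1_in _)) (s1_id Yx) addrA.
  - exact: subspace_ker_on linc.
have [n dn] : exists n, dim_mod Z0 (c0 @` Y1) n.
  apply: finite_dim_mod_quot db.
  - apply: (@subspace_image _ _ Z0 Z0) => //; split=> [z Zz|].
      by apply: subspaceB => //; apply: subspaceB.
    have linF := linear_map_finite_rank rF.
    have lin_opp G : linear_map G -> linear_map (fun z => - c0 (G z)).
      by move=> linG; apply: linear_map_opp; exact: linear_map_comp.
    have lin_id : linear_map (fun z : H => z) by [].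
    move=> c x y _ _.
    exact: (linear_map_add (linear_map_add lin_id (lin_opp _ linN)) (lin_opp _ linF)).
  - move=> _ [z Zz <-]; exists (s1 z) => //.
    rewrite s1E (linear_mapB _ _ lin_c0) (c0_id (c0_in _)) (c0_id Zz) KE.
    by rewrite (linear_mapD _ _ lin_c0) opprD addrA.
  - by move=> _ [x _ <-].
  - exact: (subspace_image sY1 linc).
by exists m, n.
Qed.

(** A perturbation [L] that is small but not of finite rank is absorbed into
    [c0]: since [V s1] inverts [c0] on [Y1] up to finite rank, [c0 + L] is
    [(1 + L V s1) c0] up to finite rank, where the first factor is bijective. *)
Lemma fredholm_dims_perturb T L F (r : R) a b : linear_map L -> 0 <= r < 1 ->
  (forall x, Z0 (L x)) -> (forall x, hnorm (L x) <= r * hnorm x) -> finite_rank Z0 F ->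
  (forall x, Y1 x -> T x = c0 x + L x + F x) ->
  fredholm_dims Y1 Z0 c0 a b ->
  exists a' b', fredholm_dims Y1 Z0 T a' b' /\ (a + b')%N = (a' + b)%N.
Proof.
move=> linL /andP[r0 r1] LZ Lr rF TE dc.
(* With this [e] the bound [r / (1 - e)] on the norm of [L V s1] is below 1. *)
pose e : R := (1 - r) / 2.
have e_gt0 : 0 < e by rewrite /e; lra.
have e01 : 0 <= e < 1 by apply/andP; split; rewrite /e; lra.
have [N [Fk [linN rFk Ne KE]]] := split_compact e_gt0.
have [V [linV NV inj Vle]] : exists V, [/\ linear_map V,
    forall x, V x + s1 (N (s1 (V x))) = x,
    forall x, x + s1 (N (s1 x)) = 0 -> x = 0
    & forall x, hnorm (V x) <= (1 - e)^-1 * hnorm x].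
  apply: (neumann (N := fun x => s1 (N (s1 x)))) => //.
    by move=> c x y; rewrite lin_s1 linN lin_s1.
  move=> x; apply: le_trans (s1_le _) _; apply: le_trans (Ne _) _.
  by rewrite ler_wpM2l ?(ltW e_gt0).
have VN x : V (x + s1 (N (s1 x))) = x.
  apply/eqP; rewrite -subr_eq0; apply/eqP/inj; set w := x + _.
  rewrite (linear_mapB _ _ lin_s1) (linear_mapB _ _ linN) (linear_mapB _ _ lin_s1).
  by rewrite addrACA -opprD NV /w subrr.
pose L' z := L (V (s1 z)).
have linL' : linear_map L' by move=> c x y; rewrite /L' lin_s1 linV linL.
have e1 : 0 < 1 - e by rewrite /e; lra.
have q01 : 0 <= r * (1 - e)^-1 < 1.
  by rewrite mulr_ge0 ?invr_ge0 ?(ltW e1) //= ltr_pdivrMr // /e; lra.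
have L'q x : hnorm (L' x) <= r * (1 - e)^-1 * hnorm x.
  apply: le_trans (Lr _) _; rewrite -mulrA ler_wpM2l //.
  apply: le_trans (Vle _) _; rewrite ler_wpM2l ?invr_ge0 ?(ltW e1) //.
have [linW injW surjW] := neumann_bijective sZ0 linL' q01 L'q (fun z => LZ _).
have linc := linear_compl.
have dW := fredholm_dims_comp_bijective sY1 sZ0 linc linW injW surjW dc.
have linWc : linear_on Y1 Z0 (fun x => c0 x + L' (c0 x)).
  by split=> [x Yx|u x y _ _]; [apply/linW.1/c0_in | rewrite lin_c0 linW.2].
have rF' : finite_rank Z0 (fun x => F x + - L (V (s1 (Fk x)))).
  apply: finite_rankD => //; apply: finite_rankN => //.
  by apply: (finite_rank_map (L := fun x => L (V (s1 x)))) rFk => // z _; exact: LZ.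
have [a' [b' [dT E]]] := fredholm_dims_finite_rank sY1 sZ0 linWc rF' dW.
exists a', b'; split=> //; apply: fredholm_dims_ext dT => x Yx.
rewrite TE // /L' [in V _]c0E.
have -> : s1 (s1 x + K x) = (x + s1 (N (s1 x))) + s1 (Fk x).
  by rewrite KE !(linear_mapD _ _ lin_s1) !(s1_id Yx) addrA.
rewrite (linear_mapD _ _ linV) VN (linear_mapD _ _ linL).
by rewrite (addrA (c0 x)) [F x - _]addrC addrA addrK.
Qed.

Section Graphs.
Variables G0 G1 : H -> H.
Hypotheses (bG0 : bounded_operator Y0 Z0 G0) (bG1 : bounded_operator Y1 Z1 G1).
Hypothesis G01 : calkin_norm Y0 Z0 G0 * calkin_norm Y1 Z1 G1 < 1.
Let g0 x := G0 (s0 x).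
Let g1 x := G1 (s1 x).

Let sZ1 := (decomp_subspace D1).2.

Let g1_in x : Z1 (g1 x). Proof. by apply: bG1.1.1; exact: projY. Qed.

Let lin_g0 : linear_map g0.
Proof. by move=> a x y; rewrite /g0 lin_s0 bG0.1.2 //; exact: projY. Qed.
Let lin_g1 : linear_map g1.
Proof. by move=> a x y; rewrite /g1 lin_s1 bG1.1.2. Qed.

(** Every term other than [c0 x] and [g0 (g1 x)] contains [K]: on [Y1] the
    projection [s0] is [- K], and on [Z1] the projection [c0] is [K]. *)
Lemma graph_operatorE x : Y1 x ->
  graph_defect Y0 G0 (x + G1 x) = c0 x + K (g1 x) + g0 (K x) - g0 (g1 x).
Proof.
move=> Yx; have G1x : G1 x = g1 x by rewrite /g1 s1_id.
have s1g : s1 (g1 x) = 0 by exact: (decomp_proj0 D1).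
have KgE : K (g1 x) = c0 (g1 x) by rewrite c0E s1g add0r.
have KxE : K x = - s0 x by rewrite /K s1_id // subrr sub0r.
have gKx : g0 (K x) = - g0 x.
  rewrite KxE -sub0r (linear_mapB _ _ lin_g0) (linear_map0 lin_g0) sub0r.
  by rewrite /g0 /s0 (proj_id sY0 pY0 (projY pY0 x)).
rewrite G1x /graph_defect -/s0 -/(c0 _) -/(g0 _) KgE gKx.
by rewrite (linear_mapD _ _ lin_c0) (linear_mapD _ _ lin_g0) opprD addrA.
Qed.

Lemma fredholm_dims_graph_operator a b : fredholm_dims Y1 Z0 c0 a b ->
  exists a' b', fredholm_dims Y1 Z0 (fun x => graph_defect Y0 G0 (x + G1 x)) a' b' /\
    (a + b')%N = (a' + b)%N.
Proof.
have [p [q [pP qP pq]]] := lt1_product_margin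
  (calkin_norm_ge0 _ sY0 sZ0) (calkin_norm_ge0 _ sY1 sZ1) G01.
have p0 : 0 < p := le_lt_trans (calkin_norm_ge0 _ sY0 sZ0) pP.
have q0 : 0 < q := le_lt_trans (calkin_norm_ge0 _ sY1 sZ1) qP.
have [h0 [lin_h0 h0p rF0]] := calkin_approx sY0 pY0 sZ0 bG0 pP.
have [h1 [lin_h1 h1q rF1]] := calkin_approx sY1 pY1 sZ1 bG1 qP.
(* With this [e] the bound [e q + p e + p q] equals [(1 + p q) / 2 < 1]. *)
pose e : R := (1 - p * q) / (2 * (p + q)).
have pq_gt0 : 0 < p + q by exact: addr_gt0.
have e_gt0 : 0 < e by rewrite divr_gt0 ?subr_gt0 ?mulr_gt0.
have eE : e * (p + q) = (1 - p * q) / 2 by rewrite /e invfM mulrA divfK ?gt_eqF.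
have [N [F [linN rF Ne KE]]] := split_compact e_gt0.
pose r := e * q + p * e + p * q.
have r01 : 0 <= r < 1.
  apply/andP; split; last by rewrite /r [p * e]mulrC -mulrDr [q + p]addrC eE; lra.
  by rewrite /r; nra.
pose L x := c0 (N (h1 x) + h0 (N x) - h0 (h1 x)).
(* [P1], [P2] and [P3] are the finite-rank differences between [K g1], [g0 K],
   [g0 g1] and their small models [N h1], [h0 N], [h0 h1]. *)
pose P1 x := N (g1 x - h1 x) + F (g1 x).
pose P2 x := h0 (F x) + (g0 (K x) - h0 (K x)).
pose P3 x := h0 (g1 x - h1 x) + (g0 (g1 x) - h0 (g1 x)).
pose P x := P1 x + P2 x - P3 x.
apply: (fredholm_dims_perturb (L := L) (F := fun x => c0 (P x)) (r := r)) => //.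
- apply: (linear_map_comp lin_c0).
  exact: (linear_map_add (linear_map_add (linear_map_comp linN lin_h1)
    (linear_map_comp lin_h0 linN)) (linear_map_opp (linear_map_comp lin_h0 lin_h1))).
- by move=> x; exact: c0_in.
- move=> x; apply: le_trans (c0_le _) _; apply: le_trans (hnormB _ _) _.
  rewrite /r !mulrDl; apply: lerD; first (apply: le_trans (hnormD _ _) _; apply: lerD).
  + by apply: le_trans (Ne _) _; rewrite -mulrA ler_wpM2l ?(ltW e_gt0).
  + by apply: le_trans (h0p _) _; rewrite -mulrA ler_wpM2l ?(ltW p0).
  + by apply: le_trans (h0p _) _; rewrite -mulrA ler_wpM2l ?(ltW p0).
- apply: (finite_rank_map (Z := setT) lin_c0) => //.
  have sT : linear_subspace (setT : set H) by split.
  have weaken Z L' : finite_rank Z L' -> finite_rank setT L'.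
    by apply: (finite_rank_map (L := id)).
  have linK : linear_map K by move=> u x y; exact: cK.1.2.
  have rF0T := weaken _ _ rF0; have rF1T := weaken _ _ rF1.
  apply: finite_rankD; [apply: finite_rankD | apply: finite_rankN => //];
    apply: finite_rankD.
  + exact: (finite_rank_map linN _ rF1T).
  + exact: (finite_rank_comp lin_g1 rF).
  + exact: (finite_rank_map lin_h0 _ rF).
  + exact: (finite_rank_comp linK rF0T).
  + exact: (finite_rank_map lin_h0 _ rF1T).
  + exact: (finite_rank_comp lin_g1 rF0T).
- move=> x Yx; rewrite -addrA -(linear_mapD _ _ lin_c0).
  have Z0A := graph_defect_in D0 bG0 (x + G1 x).
  rewrite -[LHS](c0_id Z0A) graph_operatorE // -[in RHS](c0_id (c0_in x)).
  rewrite -(linear_mapD _ _ lin_c0); congr c0.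
  have -> : K (g1 x) = N (h1 x) + P1 x.
    by rewrite KE /P1 (linear_mapB _ _ linN) addrA subrKC.
  have -> : g0 (K x) = h0 (N x) + P2 x.
    by rewrite /P2 addrA -(linear_mapD _ _ lin_h0) -KE subrKC.
  have -> : g0 (g1 x) = h0 (h1 x) + P3 x.
    by rewrite /P3 addrA -(linear_mapD _ _ lin_h0) !subrKC.
  rewrite /P; move: (N (h1 x)) (h0 (N x)) (h0 (h1 x)) (P1 x) (P2 x) (P3 x) (c0 x).
  move=> n1 n2 n3 p1 p2 p3 c.
  by rewrite -!(addrA c) addrACA opprD [n1 + n2 + _ + _]addrACA.
Qed.

End Graphs.

End NearlyComplementary.
End FredholmPerturbation.

(** * The pair of graph projections *)

Section GraphPair.
Context {R : realType} {H : hilbertType R}.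
Implicit Types (x y z u v : H) (Y Z : set H).

Lemma quotient_dimE Z V n : linear_subspace V ->
  has_quotient_dim Z V n -> @quotient_dim R H Z V = n.
Proof.
move=> sV dn; rewrite /quotient_dim; case: xgetP => [m _ /= dm|/(_ n)//].
exact: dim_mod_unique sV dm dn.
Qed.

Lemma fredholm_of_dims Y Z T a b : linear_subspace Y -> @bounded_operator R H Y Z T ->
  fredholm_dims Y Z T a b ->
  fredholm_operator Y Z T /\ fredholm_index Y Z T = a%:Z - b%:Z.
Proof.
move=> sY bT [da db]; split; first by split=> //; [exists a | exists b].
rewrite /fredholm_index; congr (_%:Z - _%:Z); apply: quotient_dimE => //.
  exact: subspace0.
exact: (subspace_image sY bT.1).
Qed.

Lemma bounded_compl_proj Y X : closed_subspace Y ->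
  @bounded_operator R H X (range (fun x => x - proj Y x)) (fun x => x - proj Y x).
Proof.
move=> cY; have pY := closed_projectable cY; have sY := closed_subspace_subspace cY.
split; last by exists 1 => x _; rewrite mul1r; exact: hnorm_subproj.
split=> [x _|a x y _ _]; first by exists x.
by rewrite proj_linear // opprD addrACA -scalerBr.
Qed.

(** The kernels correspond under [x |-> x + G1 x], and the cokernels under the
    restriction of [Q] to [Z0]; both use that [Q] and the graph defect vanish on
    the same vectors, together with [Q (defect v) = Q v]. *)
Lemma fredholm_dims_graph_pair Y0 Z0 Y1 Z1 (G0 G1 : H -> H) a b :
  let Q x := x - proj (graph Y0 G0) x in
  orthogonal_decomposition Y0 Z0 -> orthogonal_decomposition Y1 Z1 ->
  bounded_operator Y0 Z0 G0 -> bounded_operator Y1 Z1 G1 ->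
  fredholm_dims Y1 Z0 (fun x => graph_defect Y0 G0 (x + G1 x)) a b ->
  fredholm_dims (graph Y1 G1) (range Q) Q a b.
Proof.
move=> Q D0 D1 bG0 bG1; set A := fun x => graph_defect Y0 G0 (x + G1 x).
have [sY0 sZ0] := decomp_subspace D0; have [sY1 sZ1] := decomp_subspace D1.
have pY0 := decomp_projectable D0; have pY1 := decomp_projectable D1.
have cGr0 := closed_graph D0 bG0; have cGr1 := closed_graph D1 bG1.
have sGr0 := closed_subspace_subspace cGr0.
have sGr1 := closed_subspace_subspace cGr1.
have pGr0 := closed_projectable cGr0.
have [linG1 _] := bG1.
have lin_B := graph_defect_linear D0 bG0.
have lin_Q : linear_map Q.
  by move=> c x y; rewrite /Q proj_linear // opprD addrACA -scalerBr.
have lin_graph : linear_on Y1 (graph Y1 G1) (fun x => x + G1 x).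
  split=> [x Yx|c x y Yx Yy]; first by exists x.
  by rewrite linG1.2 // scalerDr addrACA.
have Q0 v : Q v = 0 <-> graph_defect Y0 G0 v = 0.
  split=> [/eqP|Bv].
    rewrite subr_eq0 => /eqP vE; have := projY pGr0 v.
    by rewrite -vE {1}(graphE D0 bG0).
  by rewrite /Q proj_id ?subrr // (graphE D0 bG0).
have QB v : Q (graph_defect Y0 G0 v) = Q v.
  apply/eqP; rewrite -subr_eq0 -(linear_mapB _ _ lin_Q); apply/eqP/Q0.
  rewrite (linear_mapB _ _ lin_B) [X in X - _](graph_defect_id D0 bG0) ?subrr //.
  exact: (graph_defect_in D0 bG0).
have lin_A : linear_on Y1 Z0 A.
  split=> [x _|c x y Yx Yy]; first exact: (graph_defect_in D0 bG0).
  by rewrite /A lin_graph.2 // lin_B.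
have lin_QT X : linear_on X (range Q) Q by split=> [x _|c x y _ _]; [exists x | exact: lin_Q].
move=> [da db]; split.
- apply: (dim_mod_transfer (T := fun x => x + G1 x) _ _ _ _ _ da).
  + exact: (subspace_ker_on sY1 lin_A).
  + split=> [x [Yx Ax]|c x y [Yx _] [Yy _]]; last exact: lin_graph.2.
    by split; [exists x | apply/Q0].
  + exact: subspace0.
  + move=> x [Yx _] /=; split=> [xG|->].
      have := linear_map0 (proj_linear sY1 pY1); rewrite -xG.
      rewrite (linear_mapD _ _ (proj_linear sY1 pY1)) proj_id //.
      by rewrite (decomp_proj0 D1) ?addr0 //; exact: linG1.1.
    by rewrite (linear_on0 sY1 linG1) addr0.
  + move=> _ [[x Yx <-] /Q0 Ax]; exists x => //=; exact: subrr.
- apply: (dim_mod_transfer (T := Q) _ _ _ _ _ db) => //.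
  + exact: (subspace_image sGr1 (lin_QT _)).
  + move=> z Zz; split=> [[_ [x Yx <-] QxE]|[x Yx <-]].
      exists x => //; rewrite /A -[RHS](graph_defect_id D0 bG0 Zz); apply/eqP.
      rewrite -subr_eq0 -(linear_mapB _ _ lin_B); apply/eqP/Q0.
      by rewrite (linear_mapB _ _ lin_Q) QxE subrr.
    by exists (x + G1 x); [exists x | rewrite QB].
  + move=> _ [v _ <-]; exists (graph_defect Y0 G0 v); first exact: (graph_defect_in D0 bG0).
    by rewrite QB subrr; exact: (subspace_image sGr1 (lin_QT _)).1.
Qed.

End GraphPair.

Theorem theorem3p11 (R : realType) (H : hilbertType R)
    (Y0 Z0 Y1 Z1 : set H) (G0 G1 : H -> H) :
  let S0 := proj Y0 in
  let S1 := proj Y1 in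
  let P0 := proj (graph Y0 G0) in
  let P1 := proj (graph Y1 G1) in
  orthogonal_decomposition Y0 Z0 ->
  orthogonal_decomposition Y1 Z1 ->
  compact_operator [set: H] [set: H] (fun x => x - S1 x - S0 x) ->
  bounded_operator Y0 Z0 G0 ->
  bounded_operator Y1 Z1 G1 ->
  calkin_norm Y0 Z0 G0 * calkin_norm Y1 Z1 G1 < 1 ->
  fredholm_pair P1 (fun x => x - P0 x) /\
  pair_index P1 (fun x => x - P0 x) = pair_index S1 (fun x => x - S0 x).
Proof.
move=> S0 S1 P0 P1 D0 D1 cK bG0 bG1 G01.
have [sY1 _] := decomp_subspace D1; have pY1 := decomp_projectable D1.
have cY0 : closed_subspace Y0 by case: D0.
have cGr0 := closed_graph D0 bG0; have cGr1 := closed_graph D1 bG1.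
have [a [b dS]] := fredholm_complementary D0 D1 cK.
have [a' [b' [dA E]]] := fredholm_dims_graph_operator D0 D1 cK bG0 bG1 G01 dS.
have dP := fredholm_dims_graph_pair D0 D1 bG0 bG1 dA.
have rP1 := range_proj (closed_subspace_subspace cGr1) (closed_projectable cGr1).
have [fP iP] := fredholm_of_dims (closed_subspace_subspace cGr1)
  (bounded_compl_proj _ cGr0) dP.
have rS1 := range_proj sY1 pY1; have rS0 := range_decomp_compl D0.
have bS := bounded_compl_proj Y1 cY0; rewrite rS0 in bS.
have [_ iS] := fredholm_of_dims sY1 bS dS.
split; first split.
- by exists (graph Y1 G1).
- exact: is_projection_compl.
- by rewrite rP1.
- by rewrite /pair_index rP1 rS1 rS0 iP iS; lia.
Qed.
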